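(* Let $\bm n\in\mathbb N^r$, $\alpha>-1$, and let $\bm c=(c_1,\dots,c_r)\in\mathbb R_{>0}^r$ be such that $c_i\neq c_j$ for $i\neq j$. For $0<t\le2$, the Type II multiple Laguerre polynomials of the second kind satisfy the interlacing $$\mathcal L^{(\alpha,\bm c)}_{\bm n}\preccurlyeq\mathcal L^{(\alpha+t,\bm c)}_{\bm n}.$$
   Context: $\mathbb N=\{1,2,\dots\}$, $|\bm n|=n_1+\dots+n_r$. Type II multiple Laguerre polynomial of the second kind $\mathcal L^{(\alpha,\bm c)}_{\bm n}$: the monic polynomial of degree $|\bm n|$ with $\int_0^\infty\mathcal L^{(\alpha,\bm c)}_{\bm n}(x)x^{k+\alpha}e^{-c_jx}dx=0$ for $k=0,\dots,n_j-1$, $j=1,\dots,r$. Explicitly (known), $$\mathcal L^{(\alpha,\bm c)}_{\bm n}(x)=\sum_{k_1=0}^{n_1}\cdots\sum_{k_r=0}^{n_r}(-1)^{|\bm k|}\binom{|\bm n|+\alpha}{|\bm k|}\prod_{j=1}^r\binom{n_j}{k_j}\frac{|\bm k|!}{c_1^{k_1}\cdots c_r^{k_r}}x^{|\bm n|-|\bm k|},\qquad |\bm k|=k_1+\dots+k_r.$$ Interlacing: for real-rooted polynomials $p,q$ of the same degree $N$ with zeros $\lambda_1(p)\le\dots\le\lambda_N(p)$, $\lambda_1(q)\le\dots\le\lambda_N(q)$, $p\preccurlyeq q$ means $\lambda_1(p)\le\lambda_1(q)\le\lambda_2(p)\le\lambda_2(q)\le\dots\le\lambda_N(p)\le\lambda_N(q)$.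 *)

(* Defs.v *)
From mathcomp Require Import all_boot all_order all_algebra.
From mathcomp Require Import all_classical all_reals all_analysis.

Set Implicit Arguments.
Unset Strict Implicit.
Unset Printing Implicit Defensive.

Import Order.TTheory GRing.Theory Num.Theory.
Import numFieldNormedType.Exports.

Local Open Scope classical_set_scope.
Local Open Scope ring_scope.

(* The integrals below are taken over ]0, +oo[ rather than [0, +oo[ because
   x `^ a is a junk value at x = 0 when a < 0.  For alpha > -1 and c j > 0 the
   integrands are Lebesgue integrable, so the extended-real integral is the
   usual one.  Those parameter conditions are not part of the predicate. *)
Definition is_mlaguerre2 (R : realType) (r : nat) (n : 'I_r -> nat)
    (alpha : R) (c : 'I_r -> R) (p : {poly R}) : Prop :=
  [/\ p \is monic,
      size p = (\sum_(j < r) n j).+1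
    & forall (j : 'I_r) (k : nat), (k < n j)%N ->
        (\int[@lebesgue_measure R]_(x in `]0%R, +oo[)
           (p.[x] * x `^ (k%:R + alpha) * expR (- (c j * x)))%:E = 0)%E].

(* [s] lists the zeros of [p] with multiplicity, in nondecreasing order; such
   an [s] exists iff [p] is nonzero and all its complex zeros are real. *)
Definition sorted_zeros (R : realType) (p : {poly R}) (s : seq R) : Prop :=
  [/\ p != 0,
      p = lead_coef p *: \prod_(z <- s) ('X - z%:P)
    & sorted <=%R s].

Definition interlaces (R : realType) (p q : {poly R}) : Prop :=
  exists s t : seq R,
    [/\ sorted_zeros p s, sorted_zeros q t, size s = size t,
        forall i, (i < size s)%N -> s`_i <= t`_i
      & forall i, (i.+1 < size s)%N -> t`_i <= s`_i.+1].

(* Main.v *)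
(** Write [P_a] for the polynomial of parameter [a], normalized by [P_a(0) = 1].
    The orthogonality relations say that [sum_i p_i (alpha+1)_i y^i] vanishes to
    order [n_j] at [1/c_j], hence the coefficients of [P_a] are those of
    [prod_j (1 - c_j x)^(n_j)] divided by [(a+1)_i].

    By the Rodrigues formula [P_a] is obtained from a constant by operators
    [x^(1-b) (D - c) x^b], so its zeros are positive and simple; comparing logarithmic
    derivatives along this chain, the zeros increase with [a].  By monotonicity it
    only remains to show that the k-th zero of [P_(a+2)] does not exceed the
    (k+1)-st zero of [P_a].

    Up to a constant, [P_a(z)] is the polarization of the classical Laguerre
    polynomial [l_a] of degree [|n|] evaluated at the points [c_j z].  By the half-plane
    case of Grace's theorem, it is enough that [l_a - i l_(a+2)] has no zero in the closed
    upper half-plane: then neither has [P_a - i P_(a+2)], the Wronskian of the pair has a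
    constant sign and the zeros interlace.  The claim on [l_a] follows from
    the expressions of [l_a] and [l_(a+2)] in terms of [l_(a+1)] and its derivative. *)

Require Import Defs.
From mathcomp Require Import all_boot all_order all_algebra.
From mathcomp Require Import all_classical all_reals all_analysis.
From mathcomp Require Import measurable_realfun ring lra polyrcf.

Import Order.TTheory GRing.Theory Num.Theory.
Import numFieldNormedType.Exports.

Local Open Scope ring_scope.

Set Implicit Arguments.
Unset Strict Implicit.
Unset Printing Implicit Defensive.

(** * Moments of the weight [x^a e^(-c x)] on the positive half-line *)

Section GammaIntegral.
Local Open Scope classical_set_scope.
Variable R : realType.
Implicit Types a c x : R.
Notation mu := (@lebesgue_measure R).

Definition gammak a c x := x `^ a * expR (- (c * x)).

Lemma powR_succ x a : 0 < x -> x `^ (a + 1) = x * x `^ a.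
Proof.
move=> x0; rewrite powRD; first by rewrite powRr1 ?ltW// mulrC.
by rewrite (gt_eqF x0) implybT.
Qed.

Lemma gammak_ge0 a c x : 0 <= gammak a c x.
Proof. by rewrite mulr_ge0 ?powR_ge0 ?expR_ge0. Qed.

Lemma is_derive_gammak a c x : 0 < x ->
  is_derive x 1 (gammak (a + 1) c) ((a + 1) * gammak a c x - c * gammak (a + 1) c x).
Proof.
move=> x0.
have He : is_derive x 1 (fun y => expR (- (c * y))) (- c * expR (- (c * x))).
  have := @is_derive1_comp _ expR (fun y => - (c * y)) x _ (- c) (is_derive_expR _) _.
  by rewrite mulrC; apply; apply: is_derive_eq; rewrite /GRing.scale/= mulr1.
have Hp := is_derive1_powR (a + 1) x0.
have := @is_deriveM _ _ _ _ x 1 _ _ Hp He.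
move=> H; apply: (is_derive_eq H).
by rewrite addrK /gammak /GRing.scale/=; ring.
Qed.

Lemma continuous_gammak a c x : 0 < x -> {for x, continuous (gammak a c)}.
Proof.
move=> x0; have [H _] := is_derive_gammak (a - 1) c x0.
by rewrite subrK in H; apply/differentiable_continuous/derivable1_diffP.
Qed.

Lemma measurable_gammak a c D : measurable_fun D (gammak a c).
Proof.
apply: measurable_funTS; apply: measurable_funM; first exact: measurable_powR.
by apply: measurableT_comp => //; apply: measurableT_comp => //; apply: measurable_funM.
Qed.

Lemma FTC2_pos (f F : R -> R) (u v : R) : 0 < u -> u < v ->
  (forall x, 0 < x -> {for x, continuous f}) ->
  (forall x, 0 < x -> is_derive x 1 F (f x)) ->
  (\int[mu]_(x in `[u, v]) (f x)%:E = (F v - F u)%:E)%E.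
Proof.
move=> u0 uv cf dF; have v0 := lt_trans u0 uv.
have cF x : 0 < x -> {for x, continuous F}.
  by move=> x0; have [H _] := dF x x0; apply/differentiable_continuous/derivable1_diffP.
rewrite (@continuous_FTC2 _ f F)//.
- apply: continuous_in_subspaceT => x /set_mem/=; rewrite in_itv/= => /andP[ux _].
  exact/cf/(lt_le_trans u0).
- split=> [x||].
  + by rewrite in_itv/= => /andP[ux _]; have [] := dF x (lt_trans u0 ux).
  + exact/cvg_at_right_filter/cF.
  + exact/cvg_at_left_filter/cF.
- move=> x; rewrite in_itv/= => /andP[ux _]; rewrite derive1E.
  by have [_ ->] := dF x (lt_trans u0 ux).
Qed.

(** Compact intervals that avoid 0, where the kernel may be unbounded; the right end [n + 2] keeps
    them nondegenerate already for [n = 0]. *)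
Definition exhaust n : set R := `[n.+1%:R^-1, n.+2%:R]%classic.

Lemma exhaust_lt n : n.+1%:R^-1 < n.+2%:R :> R.
Proof. by apply: (@le_lt_trans _ _ 1); rewrite ?invf_le1 ?ler1n ?ltr1n. Qed.

Lemma exhaust_pos n x : exhaust n x -> 0 < x.
Proof. by rewrite /exhaust/= in_itv/= => /andP[+ _]; apply: lt_le_trans; rewrite invr_gt0. Qed.

Lemma nondecreasing_exhaust : nondecreasing_seq exhaust.
Proof.
move=> m n mn; apply/subsetPset => x; rewrite /exhaust/= !in_itv/= => /andP[h1 h2].
apply/andP; split; last by apply: (le_trans h2); rewrite ler_nat.
by apply: le_trans h1; rewrite lef_pV2 ?posrE// ler_nat.
Qed.

Lemma bigcup_exhaust : \bigcup_n exhaust n = `]0, +oo[%classic.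
Proof.
apply/seteqP; split=> x /=; first by move=> [n _ /exhaust_pos]; rewrite in_itv/= andbT.
rewrite in_itv/= andbT => x0.
exists (maxn (Num.truncn x) (Num.truncn x^-1)) => //; rewrite /exhaust/= in_itv/=; apply/andP; split.
  rewrite -[leRHS]invrK lef_pV2 ?posrE ?invr_gt0//; apply/ltW.
  by apply: lt_le_trans (truncnS_gt _) _; rewrite ler_nat ltnS leq_maxr.
apply/ltW; apply: lt_le_trans (truncnS_gt _) _.
by rewrite ler_nat ltnS leqW// leq_maxl.
Qed.

Lemma exhaust_integral (f : R -> R) : measurable_fun setT f -> (forall x, 0 < x -> 0 <= f x) ->
  (\int[mu]_(x in exhaust n) (f x)%:E @[n --> \oo] --> \int[mu]_(x in `]0%R, +oo[) (f x)%:E)%E.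
Proof.
move=> mf f0; rewrite -bigcup_exhaust; apply: ge0_nondecreasing_set_cvg_integral.
- exact: nondecreasing_exhaust.
- by move=> i; exact: measurable_itv.
- by move=> i; apply/measurable_EFinP/measurable_funTS.
- by move=> i x /exhaust_pos x0; rewrite lee_fin f0.
Qed.

(** Dominates the kernel in the two limit arguments below. With a natural [k >= b],
    [x^b <= 1 + x^k], and [e^(c x)] is at least 1 plus its Taylor term of degree [2 k]. *)
Lemma powR_sqr_exp_bound b c : 0 < b -> 0 < c ->
  exists2 C, 0 <= C & forall x, 0 < x -> (1 + x `^ b) ^+ 2 * expR (- (c * x)) <= C.
Proof.
move=> b0 c0; pose k := (Num.truncn b).+1.
have bk : b <= k%:R by apply/ltW/truncnS_gt.
pose D : R := (2 * k)`!%:R / c ^+ (2 * k).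
have D0 : 0 <= D by rewrite divr_ge0 ?exprn_ge0 ?ltW.
exists (8 + 2 * D); first by rewrite addr_ge0// mulr_ge0.
move=> x x0; rewrite expRN ler_pdivrMr ?expR_gt0//.
have xk : 0 <= x ^+ k by rewrite exprn_ge0 ?ltW.
have h1 : x `^ b <= 1 + x ^+ k.
  have [x1|x1] := leP 1 x.
    by apply: (le_trans (ler_powR x1 bk)); rewrite powR_mulrn ?ler_wpDl// ltW.
  have : x `^ b <= x `^ 0 by apply: ger_powR; rewrite ?x0 ltW.
  by rewrite powRr0 => /le_trans; apply; rewrite lerDl.
have DD : 0 < D by rewrite divr_gt0 ?exprn_gt0 ?ltr0n ?fact_gt0.
have h2 : 1 + x ^+ (2 * k) / D <= expR (c * x).
  have := @expR_ge1Dxn R (c * x) (2 * k).-1 (mulr_ge0 (ltW c0) (ltW x0)).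
  by rewrite prednK ?muln_gt0// exprMn /D invf_div mulrA [x ^+ _ * _]mulrC.
have h3 : x ^+ (2 * k) = (x ^+ k) ^+ 2 by rewrite mulnC exprM.
have p0 := powR_ge0 x b.
apply: (@le_trans _ _ (8 + 2 * (x ^+ k) ^+ 2)).
  apply: (@le_trans _ _ ((2 + x ^+ k) ^+ 2)); first by rewrite ler_sqr ?nnegrE; lra.
  have := sqr_ge0 (x ^+ k - 2); nra.
have hD : D * ((x ^+ k) ^+ 2 / D) = (x ^+ k) ^+ 2 by field; rewrite gt_eqF.
move: h2; rewrite h3 => h2.
have E0 : 0 <= (x ^+ k) ^+ 2 / D by rewrite divr_ge0 ?sqr_ge0.
apply: (@le_trans _ _ ((8 + 2 * D) * (1 + (x ^+ k) ^+ 2 / D))); last first.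
  by rewrite ler_wpM2l// addr_ge0// mulr_ge0.
set E := _ / D in hD E0 *.
rewrite (_ : (8 + 2 * D) * (1 + E) = 8 + 8 * E + 2 * D + 2 * (D * E)); last by ring.
by rewrite hD; lra.
Qed.

Lemma gammak_integral_lty a c : -1 < a -> 0 < c ->
  (\int[mu]_(x in `]0%R, +oo[) (gammak a c x)%:E < +oo)%E.
Proof.
move=> a1 c0; have b0 : 0 < a + 1 by rewrite -ltrBlDr sub0r.
have [C C0 HC] := powR_sqr_exp_bound b0 c0.
(* The kernel is dominated by a multiple of [g = G'], with [G] bounded. *)
pose G x := - (1 + x `^ (a + 1))^-1.
pose g x := (a + 1) * x `^ a / (1 + x `^ (a + 1)) ^+ 2.
have pos x : 0 < 1 + x `^ (a + 1) by rewrite ltr_pwDl ?powR_ge0.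
have dG x : 0 < x -> is_derive x 1 G (g x).
  move=> x0.
  have h : is_derive x 1 (fun y => 1 + y `^ (a + 1)) ((a + 1) * x `^ a).
    have := is_derive1_powR (a + 1) x0; rewrite addrK => hp.
    by apply: (is_derive_eq (is_deriveD (is_derive_cst (1 : R) x 1) hp)); rewrite add0r.
  have H := is_deriveV (f := fun y => 1 + y `^ (a + 1)) (lt0r_neq0 (pos x)) h.
  have := @is_deriveN _ _ _ _ _ _ _ H => H2.
  apply: (is_derive_eq H2); rewrite /GRing.scale/= /g; field.
  exact: lt0r_neq0.
have cg x : 0 < x -> {for x, continuous g}.
  move=> x0.
  have cp (b : R) : {for x, continuous (fun y : R => y `^ b)}.
    by have [H _] := is_derive1_powR b x0; apply/differentiable_continuous/derivable1_diffP.
  apply: cvgM; first by apply: cvgM; [exact: cvg_cst|exact: cp].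
  apply: cvgV; first by rewrite expf_neq0// lt0r_neq0.
  rewrite expr2; apply: cvgM; (apply: cvgD; [exact: cvg_cst|exact: cp]).
have intg n : (\int[mu]_(x in exhaust n) (gammak a c x)%:E <= (C / (a + 1))%:E)%E.
  apply: (@le_trans _ _ (\int[mu]_(x in exhaust n) ((C / (a + 1)) * g x)%:E)%E).
    apply: ge0_le_integral => //.
    - exact: measurable_itv.
    - by move=> x _; rewrite lee_fin gammak_ge0.
    - by apply/measurable_EFinP; exact: measurable_gammak.
    - apply/measurable_EFinP; apply: subspace_continuous_measurable_fun.
        exact: measurable_itv.
      apply: continuous_in_subspaceT => x /set_mem/exhaust_pos x0.
      by apply: cvgM; [exact: cvg_cst|exact: cg].
    - move=> x /exhaust_pos x0; rewrite lee_fin /gammak /g.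
      rewrite [leRHS](_ : _ = x `^ a * (C / (1 + x `^ (a + 1)) ^+ 2)); last first.
        by field; rewrite !lt0r_neq0.
      rewrite ler_wpM2l ?powR_ge0// ler_pdivlMr ?exprn_gt0//.
      by rewrite mulrC HC.
  have cg' x : 0 < x -> {for x, continuous (fun y => C / (a + 1) * g y)}.
    by move=> x0; apply: cvgM; [exact: cvg_cst|exact: cg].
  have dG' x : 0 < x -> is_derive x 1 (fun y => C / (a + 1) * G y) (C / (a + 1) * g x).
    by move=> x0; have := @is_deriveZ _ _ _ _ (C / (a + 1)) _ _ _ (dG x x0).
  have n0 : 0 < n.+1%:R^-1 :> R by rewrite invr_gt0.
  rewrite /exhaust (FTC2_pos n0 (exhaust_lt n) cg' dG') lee_fin -mulrBr ler_piMr ?divr_ge0 ?(ltW b0)//.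
  rewrite /G opprK addrC; set u := n.+1%:R^-1; set v := n.+2%:R.
  rewrite lerBlDr ler_wpDr ?invr_ge0 ?(ltW (pos _))//.
  by rewrite invf_le1// lerDl powR_ge0.
apply: (@le_lt_trans _ _ (C / (a + 1))%:E); last exact: ltry.
have cv := @exhaust_integral (gammak a c) (@measurable_gammak a c setT) (fun x _ => gammak_ge0 a c x).
rewrite -(cvg_lim _ cv)//; apply: lime_le; first by apply: cvgP cv.
by near=> n; exact: intg.
Unshelve. all: by end_near. Qed.

Lemma integrable_gammak a c : -1 < a -> 0 < c ->
  mu.-integrable `]0%R, +oo[ (EFin \o gammak a c).
Proof.
move=> a1 c0; apply/integrableP; split.
  by apply/measurable_EFinP; exact: measurable_gammak.
under eq_integral do rewrite /= ger0_norm ?gammak_ge0//.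
exact: gammak_integral_lty.
Qed.

Definition gamma_int a c : R := fine (\int[mu]_(x in `]0%R, +oo[) (gammak a c x)%:E).

Lemma gamma_intE a c : -1 < a -> 0 < c ->
  (\int[mu]_(x in `]0%R, +oo[) (gammak a c x)%:E = (gamma_int a c)%:E)%E.
Proof.
move=> a1 c0; rewrite fineK// ge0_fin_numE ?gammak_integral_lty//.
by apply: integral_ge0 => x _; rewrite lee_fin gammak_ge0.
Qed.

(** Boundary terms of the integration by parts in [gamma_int_succ]: the kernel is at most [C / x],
    used at infinity, and at most [x^a], used at 0. *)
Lemma gammak_cvg0 a c : 0 < a -> 0 < c -> gammak a c n.+2%:R - gammak a c n.+1%:R^-1 @[n --> \oo] --> (0 : R).
Proof.
move=> a0 c0; rewrite -[X in _ --> X]subr0; apply: cvgB.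
  have [C C0 HC] := powR_sqr_exp_bound (addr_gt0 a0 ltr01) c0.
  apply: (@squeeze_cvgr _ _ _ _ (cst 0) (fun n => C * n.+1%:R^-1)).
  - near=> n; rewrite gammak_ge0/=.
    have n0 : 0 < n.+2%:R :> R by [].
    apply: (@le_trans _ _ (C * n.+2%:R^-1)); last first.
      by rewrite ler_wpM2l// lef_pV2 ?posrE// ler_nat.
    rewrite ler_pdivlMr// mulrC; apply: le_trans (HC _ n0).
    rewrite /gammak mulrA -powR_succ// ler_wpM2r ?expR_ge0//.
    have := powR_ge0 (n.+2%:R : R) (a + 1); nra.
  - exact: cvg_cst.
  - rewrite -[X in _ --> X](mulr0 C); apply: cvgM; first exact: cvg_cst.
    exact: cvg_harmonic.
apply: (@squeeze_cvgr _ _ _ _ (cst 0) (fun n => n.+1%:R^-1 `^ a)).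
- near=> n; rewrite gammak_ge0/= /gammak ler_piMr ?powR_ge0//.
  by rewrite expR_le1 oppr_le0 mulr_ge0 ?ltW ?invr_gt0.
- exact: cvg_cst.
- have /cvg_at_rightP H := powR_cvg0 a0; apply: H; split=> [n|]; first by rewrite invr_gt0.
  exact: cvg_harmonic.
Unshelve. all: by end_near. Qed.

(** [gamma_int a c] is [Gamma(a + 1) / c^(a + 1)]; its functional equation comes from integrating
    the derivative of [gammak (a + 1) c] over [exhaust n] and letting [n] grow. *)
Lemma gamma_int_succ a c : -1 < a -> 0 < c -> c * gamma_int (a + 1) c = (a + 1) * gamma_int a c.
Proof.
move=> a1 c0; have b0 : 0 < a + 1 by rewrite -ltrBlDr sub0r.
have b1 : -1 < a + 1 by apply: lt_trans b0; rewrite ltrN10.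
pose I b n := fine (\int[mu]_(x in exhaust n) (gammak b c x)%:E).
have IE b n : -1 < b -> (\int[mu]_(x in exhaust n) (gammak b c x)%:E = (I b n)%:E)%E.
  move=> hb; rewrite fineK// ge0_fin_numE; last first.
    by apply: integral_ge0 => x _; rewrite lee_fin gammak_ge0.
  apply: le_lt_trans (gammak_integral_lty hb c0).
  apply: ge0_subset_integral => //; first exact: measurable_itv.
  - by apply/measurable_EFinP; exact: measurable_gammak.
  - by move=> x _; rewrite lee_fin gammak_ge0.
  - by move=> x /exhaust_pos; rewrite /= in_itv/= andbT.
have Icv b : -1 < b -> I b n @[n --> \oo] --> gamma_int b c.
  move=> hb; apply: fine_cvg; rewrite -gamma_intE//.
  exact: (@exhaust_integral (gammak b c) (@measurable_gammak b c setT) (fun x _ => gammak_ge0 b c x)).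
have key n : (a + 1) * I a n - c * I (a + 1) n = gammak (a + 1) c n.+2%:R - gammak (a + 1) c n.+1%:R^-1.
  have n0 : 0 < n.+1%:R^-1 :> R by rewrite invr_gt0.
  have int b : -1 < b -> mu.-integrable (exhaust n) (EFin \o gammak b c).
    move=> hb; apply: integrableS (integrable_gammak hb c0) => //.
      exact: measurable_itv.
    by move=> x /exhaust_pos; rewrite /= in_itv/= andbT.
  apply: EFin_inj; rewrite -(FTC2_pos n0 (exhaust_lt n) _ (fun x => @is_derive_gammak a c x)).
    rewrite -/(exhaust n) EFinB !EFinM -!IE// -!integralZl//; try exact: measurable_itv; try exact: int.
    rewrite -integralB_EFin//; [exact: measurable_itv|..].
      by apply: integrableZl (int _ a1); exact: measurable_itv.
    by apply: integrableZl (int _ b1); exact: measurable_itv.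
  move=> x x0; apply: cvgB; (apply: cvgM; [exact: cvg_cst|exact: continuous_gammak]).
apply/eqP; rewrite eq_sym -subr_eq0; apply/eqP.
have := gammak_cvg0 b0 c0; under eq_fun do rewrite -key.
move=> h; apply/esym; apply: (cvg_unique _ h) => //.
by apply: cvgB; (apply: cvgM; [exact: cvg_cst|exact: Icv]).
Qed.

Lemma gamma_int_gt0 a c : -1 < a -> 0 < c -> 0 < gamma_int a c.
Proof.
move=> a1 c0; rewrite -lte_fin -gamma_intE//.
(* On [[1, 2]], [x^a >= x^(-1) >= 1/2] because [a > -1]. *)
pose k : R := 2^-1 * expR (- (c * 2)).
have k0 : 0 < k by rewrite mulr_gt0 ?expR_gt0.
apply: (@lt_le_trans _ _ (\int[mu]_(x in `[1%R, 2%R]) (cst k%:E x))%E).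
  rewrite integral_cst; last exact: measurable_itv.
  have m0 : (0 < lebesgue_measure (`[1%R, 2%R]%classic : set R))%E.
    by rewrite lebesgue_measure_itv/= lte_fin ltr1n -EFinB lte_fin subr_gt0 ltr1n.
  by apply: mule_gt0; [rewrite lte_fin|exact: m0].
apply: (@le_trans _ _ (\int[mu]_(x in `[1%R, 2%R]) (gammak a c x)%:E)%E).
  apply: ge0_le_integral => //.
  - by move=> x _; rewrite lee_fin ltW.
  - by apply/measurable_EFinP; exact: measurable_gammak.
  - move=> x /=; rewrite in_itv/= => /andP[x1 x2]; rewrite lee_fin /k /gammak ler_pM ?expR_ge0//.
      apply: (@le_trans _ _ (x `^ -1)); last by rewrite ler_powR// ltW.
      by rewrite powR_inv1 ?lef_pV2 ?posrE//; lra.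
    by rewrite ler_expR lerN2 ler_pM2l.
apply: ge0_subset_integral => //; try exact: measurable_itv.
- by apply/measurable_EFinP; exact: measurable_gammak.
- by move=> x _; rewrite lee_fin gammak_ge0.
- by move=> x; rewrite /= !in_itv/= andbT => /andP[+ _]; apply: lt_le_trans.
Qed.
End GammaIntegral.

(** * Sign changes, positive simple zeros and one Rodrigues step *)

Lemma horner_deriv_prod_XsubC (F : fieldType) (s : seq F) (x : F) : x \notin s ->
  (\prod_(z <- s) ('X - z%:P))^`().[x] =
  (\prod_(z <- s) ('X - z%:P)).[x] * \sum_(z <- s) (x - z)^-1.
Proof.
elim: s => [|a s IHs]; first by rewrite !big_nil derivC horner0 mulr0.
rewrite in_cons negb_or => /andP[xa /IHs xs]; rewrite !big_cons.
rewrite derivM hornerD !hornerM derivXsubC hornerC mul1r xs !hornerXsubC.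
by field; rewrite subr_eq0.
Qed.

Section Roots.
Variable R : rcfType.
Implicit Types (p q : {poly R}) (s x z : nat -> R).

(** The intermediate value theorem gives a zero in each of the [n] gaps, and the degree leaves room
    for no other. The factor [e] carries the sign at [x 0]. *)
Lemma alternation_roots q n x (e : R) : size q = n.+1 ->
  (forall i, (i < n)%N -> x i < x i.+1) ->
  (forall i, (i <= n)%N -> 0 < (-1) ^+ i * e * q.[x i]) ->
  exists2 z, forall i, (i < n)%N -> x i < z i < x i.+1 &
    q = lead_coef q *: \prod_(i < n) ('X - (z i)%:P).
Proof.
move=> sq xlt qsg.
have qalt i : (i < n)%N -> q.[x i] * q.[x i.+1] < 0.
  move=> lin; have := mulr_gt0 (qsg i (ltnW lin)) (qsg i.+1 lin).
  rewrite exprS (_ : _ * (-1 * _ * _ * _) = - (((-1) ^+ i) ^+ 2 * e ^+ 2 * (q.[x i] * q.[x i.+1]))); last by ring.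
  rewrite sqrr_sign mul1r oppr_gt0 => h.
  have e0 : e != 0 by apply: contraTneq h => ->; rewrite expr0n mul0r ltxx.
  by move: h; rewrite pmulr_rlt0// exprn_even_gt0.
have [z Hz] : exists z : nat -> R, forall i, (i < n)%N -> x i < z i < x i.+1 /\ root q (z i).
  have : forall i, exists a, (i < n)%N -> x i < a < x i.+1 /\ root q a.
    move=> i; have [lin|_] := ltnP i n; last by exists 0.
    have [a + ra] := poly_ivtoo (ltW (xlt _ lin)) (qalt _ lin).
    by rewrite in_itv/= => ax; exists a.
  by move=> /boolp.choice[z Hz]; exists z.
exists z => [i /Hz[]//|].
have mono i j : (i < j)%N -> (j < n)%N -> z i < z j.
  move=> + jn; elim: j jn => // j IH jn; rewrite ltnS leq_eqVlt => ij.
  have /andP[_ h1] := (Hz j (ltnW jn)).1; have /andP[h2 _] := (Hz _ jn).1.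
  have zj := lt_trans h1 h2.
  case/orP: ij => [/eqP-> //|ij]; exact: lt_trans (IH (ltnW jn) ij) zj.
rewrite -(big_mkord xpredT (fun i => 'X - (z i)%:P)) -(big_map z xpredT (fun a => 'X - a%:P)).
apply: all_roots_prod_XsubC.
- by rewrite size_map size_iota subn0 sq.
- by apply/allP => a /mapP[i]; rewrite mem_iota/= subn0 add0n => /Hz[_ ?] -> //.
- rewrite uniq_rootsE map_inj_in_uniq ?iota_uniq// => i j.
  rewrite !mem_iota/= subn0 !add0n => iN jN zij.
  by case: (ltngtP i j) => // [/mono/(_ jN)|/mono/(_ iN)]; rewrite zij ltxx.
Qed.

Lemma signr_subn k n : (k <= n)%N -> (-1) ^+ k * (-1) ^+ n = (-1) ^+ (n - k) :> R.
Proof.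
by move=> kn; rewrite -{1}(subnK kn) exprD mulrCA -expr2 sqrr_sign mulr1.
Qed.

Lemma prod_sign (f : nat -> R) n k : (k <= n)%N ->
  (forall j, (j < k)%N -> 0 < f j) -> (forall j, (k <= j < n)%N -> f j < 0) ->
  0 < (-1) ^+ (n - k) * \prod_(j < n) f j.
Proof.
move=> kn fp fn; elim: n kn fn => [|n IHn] kn fn.
  by rewrite big_ord0 sub0n mulr1.
rewrite big_ord_recr/=; case: (ltngtP k n.+1) kn => // [kn _|kE _].
  rewrite subSn// exprS -mulrA mulN1r oppr_gt0 mulrA pmulr_rlt0 ?fn ?ltnSn ?andbT//.
  by apply: IHn => // j /andP[kj jn]; rewrite fn// kj ltnW.
rewrite kE in fp *; rewrite subnn expr0 mul1r mulr_gt0 ?fp//.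
by rewrite prodr_gt0// => j _; rewrite fp// ltnS ltnW.
Qed.

Lemma horner_deriv_prod_root s n i : (i < n)%N ->
  (\prod_(j < n) ('X - (s j)%:P))^`().[s i] =
  \prod_(j < n) (if j == i :> nat then 1 else s i - s j).
Proof.
move=> lin; rewrite (bigD1 (Ordinal lin))//= derivM derivXsubC mul1r hornerD hornerM.
rewrite hornerXsubC subrr mul0r addr0 [RHS](bigD1 (Ordinal lin))//= eqxx mul1r.
rewrite horner_prod; apply: eq_bigr => j /negbTE ji.
by rewrite hornerXsubC ifF.
Qed.

(* [x ^ (a - 1) * lag_step a c p = (x ^ a * p)' - c * (x ^ a * p)], so that
   positive zeros appear in every gap of the zeros of [x ^ a * p] by Rolle. *)
Definition lag_step (a c : R) (p : {poly R}) : {poly R} :=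
  a *: p + 'X * p^`() - c *: ('X * p).

Lemma horner_lag_step a c p y : (lag_step a c p).[y] = a * p.[y] + y * p^`().[y] - c * (y * p.[y]).
Proof. by rewrite /lag_step !hornerE. Qed.

Lemma size_lag_step a c p : c != 0 -> p != 0 ->
  size (lag_step a c p) = (size p).+1 /\ lead_coef (lag_step a c p) = - c * lead_coef p.
Proof.
move=> c0 p0.
have sX : size (c *: ('X * p)) = (size p).+1 by rewrite size_scale// mulrC size_mulX.
have lt : (size (a *: p + 'X * p^`())%R < size (- (c *: ('X * p)))%R)%N.
  rewrite size_polyN sX ltnS; apply: (leq_trans (size_polyD _ _)); rewrite geq_max; apply/andP; split.
    exact: size_scale_leq.
  have [->|p'0] := eqVneq p^`() 0; first by rewrite mulr0 size_poly0.
  by rewrite mulrC size_mulX// lt_size_deriv.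
rewrite /lag_step addrC; split; first by rewrite size_polyDl// size_polyN.
by rewrite lead_coefDl// lead_coefN lead_coefZ [_ * p]mulrC lead_coefMX mulNr.
Qed.

Definition pos_roots s n p :=
  [/\ p != 0, p = lead_coef p *: \prod_(i < n) ('X - (s i)%:P),
      forall i, (i < n)%N -> 0 < s i
    & forall i, (i.+1 < n)%N -> s i < s i.+1].

Lemma pos_roots_lt s n p i j : pos_roots s n p -> (i < j < n)%N -> s i < s j.
Proof.
move=> [_ _ _ slt] /andP[+ jn]; elim: j jn => // j IH jn; rewrite ltnS leq_eqVlt.
move=> /orP[/eqP->|ij]; first exact: slt.
exact: lt_trans (IH (ltnW jn) ij) (slt _ jn).
Qed.

Lemma horner_pos_roots s n p y : pos_roots s n p ->
  p.[y] = lead_coef p * \prod_(i < n) (y - s i).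
Proof.
move=> [_ pE _ _]; rewrite {1}pE hornerZ horner_prod; congr (_ * _).
by apply: eq_bigr => i _; rewrite hornerXsubC.
Qed.

Lemma horner_deriv_pos_roots s n p y : pos_roots s n p -> (forall i, (i < n)%N -> y != s i) ->
  p^`().[y] = p.[y] * \sum_(i < n) (y - s i)^-1.
Proof.
move=> [_ pE _ _] ys; rewrite pE derivZ !hornerZ -mulrA; congr (_ * _).
have := @horner_deriv_prod_XsubC _ [seq s i | i <- index_iota 0 n] y.
rewrite !big_map !big_mkord; apply; apply/negP => /mapP[i].
by rewrite mem_index_iota/= => /ys /eqP.
Qed.

Lemma size_pos_roots s n p : pos_roots s n p -> size p = n.+1.
Proof.
move=> [p0 pE _ _]; rewrite pE size_scale ?lead_coef_eq0// size_prod_XsubC.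
by rewrite -[index_enum _]enumT size_enum_ord.
Qed.

(** Sign alternation at 0, at the zeros of [p] and at a large [M]: [lag_step a c p] takes the value
    [a * p(0)] at 0 and [y * p'(y)] at a zero [y] of [p], and its leading coefficient has the sign
    opposite to that of [p]. *)
Lemma lag_step_roots a c p s n : 0 < a -> 0 < c -> pos_roots s n p ->
  exists2 s', pos_roots s' n.+1 (lag_step a c p) &
    forall i, (i < n)%N -> s' i < s i < s' i.+1.
Proof.
move=> a0 c0 rp; have [p0 pE sp slt] := rp; have spl := pos_roots_lt rp.
set q := lag_step a c p.
have [sq lq] := @size_lag_step a c p (lt0r_neq0 c0) p0; rewrite (size_pos_roots rp) -/q in sq lq.
(* [M >= 2 * s j] gives [M / (M - s j) <= 2], so that [M * p'(M) / p(M) <= 2 * n], while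
   [c * M > a + 2 * n]: the term in [- c] dominates at [M]. *)
pose M := 2 * (\sum_(j < n) s j) + (a + 2 * n%:R + 1) / c.
have M0 : 0 < M.
  rewrite ltr_wpDl ?mulr_ge0// ?divr_gt0 ?ltr_wpDl ?addr_ge0 ?(ltW a0)//.
  by apply: sumr_ge0 => j _; rewrite ltW ?sp.
have sM i : (i < n)%N -> 2 * s i < M.
  move=> lin; rewrite ltr_pwDr ?divr_gt0 ?ltr_wpDl ?addr_ge0 ?(ltW a0)//.
  rewrite ler_pM2l// (bigD1 (Ordinal lin))//= lerDl; apply: sumr_ge0 => j _.
  by rewrite ltW ?sp.
have sM1 i : (i < n)%N -> s i < M by move=> lin; have := sM _ lin; have := sp _ lin; lra.
pose x i := if i == 0%N then 0 else if (i <= n)%N then s i.-1 else M.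
pose e := (-1) ^+ n * lead_coef p.
have l2 : 0 < lead_coef p ^+ 2 by rewrite exprn_even_gt0 ?lead_coef_eq0.
have [||s' xs' qE] := @alternation_roots q n.+1 x e sq.
- move=> i; rewrite ltnS /x.
  case: i => [|i] /= lin.
    by case: ifP => [n0|//]; apply: sp.
  rewrite lin; case: ifP => [i2|_]; first exact: slt.
  exact: sM1.
- move=> i; rewrite /e !mulrA leq_eqVlt ltnS => /orP[/eqP->|lin].
    rewrite /x/= ltnn exprS mulN1r mulNr -expr2 sqrr_sign.
    have Ms j : (j < n)%N -> M != s j by move=> jn; rewrite gt_eqF ?sM1.
    rewrite mulN1r horner_lag_step (horner_deriv_pos_roots rp Ms) (horner_pos_roots _ rp).
    set P := \prod_(j < n) _; set S := \sum_(j < n) _.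
    have P0 : 0 < P by apply: prodr_gt0 => j _; rewrite subr_gt0 sM1.
    have S2 : M * S <= 2 * n%:R.
      rewrite mulr_sumr mulr_natr -[X in _ <= _ *+ X]card_ord -sumr_const; apply: ler_sum => j _.
      rewrite ler_pdivrMr ?subr_gt0 ?sM1//; have := sM _ (ltn_ord j); lra.
    have cM : a + 2 * n%:R < c * M.
      rewrite /M mulrDr [c * (_ / c)]mulrC divfK ?lt0r_neq0//.
      apply: ltr_wpDl; last by rewrite ltrDl.
      by rewrite mulr_ge0 ?(ltW c0)// mulr_ge0// sumr_ge0// => j _; rewrite ltW ?sp.
    rewrite (_ : - _ * _ = lead_coef p ^+ 2 * (P * (c * M - a - M * S))); last by ring.
    by rewrite mulr_gt0// mulr_gt0//; lra.
  case: i lin => [|i] lin.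
    rewrite /x/= expr0 mul1r horner_lag_step !mul0r mulr0 subr0 addr0 (horner_pos_roots _ rp).
    have := @prod_sign (fun j => 0 - s j) n 0 (leq0n n); rewrite subn0 => H.
    rewrite (_ : _ * _ = a * lead_coef p ^+ 2 * ((-1) ^+ n * \prod_(j < n) (0 - s j))); last by ring.
    apply: mulr_gt0; first by rewrite mulr_gt0.
    by apply: H => // j jn; rewrite sub0r oppr_lt0 sp.
  rewrite signr_subn// /x/= lin horner_lag_step.
  have ps : p.[s i] = 0.
    by rewrite (horner_pos_roots _ rp) (bigD1 (Ordinal lin))//= subrr mul0r mulr0.
  rewrite ps !mulr0 subr0 add0r pE derivZ hornerZ horner_deriv_prod_root//.
  have := @prod_sign (fun j => if j == i then 1 else s i - s j) n i.+1 lin.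
  set P := \prod_(j < n) _ => H.
  rewrite (_ : _ * _ = s i * lead_coef p ^+ 2 * ((-1) ^+ (n - i.+1) * P)); last by rewrite -pE; ring.
  apply: mulr_gt0; first by rewrite mulr_gt0 ?sp.
  apply: H => j.
    by rewrite ltnS leq_eqVlt; case: eqP => //= _ ji; rewrite subr_gt0 spl// ji.
  by move=> /andP[ij jn]; rewrite gtn_eqF// subr_lt0 spl// ij.
have xS i : (i < n)%N -> x i.+1 = s i by move=> lin; rewrite /x/= lin.
exists s' => [|i lin].
  have xs'2 i : (i < n.+1)%N -> 0 < s' i.
    move=> lin; have /andP[+ _] := xs' _ lin; apply: le_lt_trans.
    by case: i lin => [|i] lin //; rewrite xS// ltW// sp.
  split=> //; first by rewrite -size_poly_eq0 sq.
  move=> i lin; have /andP[_ h1] := xs' _ (ltnW lin); have /andP[h2 _] := xs' _ lin.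
  exact: lt_trans h1 h2.
have /andP[_ h1] := xs' i (ltnW lin); have /andP[h2 _] := xs' i.+1 lin.
by rewrite xS// in h1 h2; rewrite h1.
Qed.

(** At a zero [y] of [lag_step a c p], [a / y + p'(y) / p(y) = c]. If [z' i < s' i], each term of
    this sum is at most as large for [s'] as for [z'], the first one strictly smaller, since by
    interlacing the matching differences have equal signs; yet both sums equal [c]. *)
Lemma lag_step_mono a b c p q s z s' z' n : 0 < a <= b -> 0 < c ->
  pos_roots s n p -> pos_roots z n q ->
  pos_roots s' n.+1 (lag_step a c p) -> pos_roots z' n.+1 (lag_step b c q) ->
  (forall i, (i < n)%N -> s' i < s i < s' i.+1) ->
  (forall i, (i < n)%N -> z' i < z i < z' i.+1) ->
  (forall i, (i < n)%N -> s i <= z i) ->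
  forall i, (i < n.+1)%N -> s' i <= z' i.
Proof.
move=> /andP[a0 ab] c0 rp rq rp' rq' ss zz sz i lin; rewrite leNgt; apply/negP => lt.
have logd (a1 : R) p1 s1 s1' : pos_roots s1 n p1 -> pos_roots s1' n.+1 (lag_step a1 c p1) ->
    (forall i, (i < n)%N -> s1' i < s1 i < s1' i.+1) ->
    a1 / s1' i + \sum_(j < n) (s1' i - s1 j)^-1 = c /\
    (forall j, (j < i)%N -> s1 j < s1' i) /\ (forall j, (i <= j < n)%N -> s1' i < s1 j).
  move=> r1 r1' ss1; have s0 : 0 < s1' i by case: r1' => _ _ + _; apply.
  have lo j : (j < i)%N -> s1 j < s1' i.
    move=> ji; have jn : (j < n)%N by rewrite (leq_trans ji).
    have /andP[_ h] := ss1 _ jn; apply: (lt_le_trans h).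
    have [->//|nji] := eqVneq j.+1 i; apply/ltW/(pos_roots_lt r1').
    by rewrite ltn_neqAle nji ji lin.
  have hi j : (i <= j < n)%N -> s1' i < s1 j.
    move=> /andP[ij jn]; have /andP[h _] := ss1 _ jn; apply: le_lt_trans h.
    have [->//|nji] := eqVneq i j; apply/ltW/(pos_roots_lt r1').
    by rewrite ltn_neqAle nji ij ltnW.
  split=> //; have ne j : (j < n)%N -> s1' i != s1 j.
    move=> jn; have [ji|ij] := ltnP j i; first by rewrite gt_eqF ?lo.
    by rewrite lt_eqF ?hi// ij.
  have := horner_pos_roots (s1' i) r1'; rewrite (bigD1 (Ordinal lin))//= subrr mul0r mulr0.
  rewrite horner_lag_step (horner_deriv_pos_roots r1 ne); set S := \sum_(j < n) _.
  have p1n : p1.[s1' i] != 0.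
    rewrite (horner_pos_roots _ r1) mulf_neq0 ?lead_coef_eq0//; first by case: r1.
    by apply/prodf_neq0 => j _; rewrite subr_eq0 ne.
  move=> H; have {}H : p1.[s1' i] * (a1 + s1' i * S - c * s1' i) = 0 by rewrite -[RHS]H; ring.
  move/eqP: H; rewrite mulf_eq0 (negbTE p1n)/= => /eqP H.
  have s0' := lt0r_neq0 s0.
  have -> : c = (c * s1' i) / s1' i by rewrite mulfK.
  have -> : c * s1' i = a1 + s1' i * S by lra.
  by field.
have [Es [slo shi]] := logd _ _ _ _ rp rp' ss.
have [Ez [zlo zhi]] := logd _ _ _ _ rq rq' zz.
have s0 : 0 < s' i by case: rp' => _ _ + _; apply.
have z0 : 0 < z' i by case: rq' => _ _ + _; apply.
suff : a / s' i + \sum_(j < n) (s' i - s j)^-1 < b / z' i + \sum_(j < n) (z' i - z j)^-1.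
  by rewrite Es Ez ltxx.
apply: ltr_leD.
  by rewrite ltr_pdivrMr// mulrAC ltr_pdivlMr// (lt_le_trans (y := a * s' i)) ?ltr_pM2l ?ler_pM2r.
apply: ler_sum => j _; have [ji|ij] := ltnP j i.
  have := slo _ ji; have := zlo _ ji; have := sz _ (ltn_ord j) => h1 h2 h3.
  by rewrite lef_pV2 ?posrE ?subr_gt0//; lra.
have ijn : (i <= j < n)%N by rewrite ij ltn_ord.
have := shi _ ijn; have := zhi _ ijn; have := sz _ (ltn_ord j) => h1 h2 h3.
by rewrite lef_nV2 ?negrE ?subr_lt0//; lra.
Qed.

End Roots.

(** * Rescaled multiple Laguerre polynomials and their coefficients *)

Section LaguerrePoly.
Variable F : numFieldType.
Implicit Types (a c : F) (cs : seq F).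

Definition poch a n := \prod_(l < n) (a + l%:R).

Definition rate_poly cs : {poly F} := \prod_(c <- cs) (1 - c *: 'X).

(* The paper's polynomial, rescaled to take the value 1 at 0; [cs] lists each
   rate [c_j] with multiplicity [n_j]. *)
Definition laguerre a cs : {poly F} :=
  \poly_(i < (size cs).+1) ((rate_poly cs)`_i / poch (a + 1) i).

Lemma pochS a n : poch a n.+1 = poch a n * (a + n%:R).
Proof. by rewrite /poch big_ord_recr. Qed.

Lemma poch0 a : poch a 0 = 1. Proof. by rewrite /poch big_ord0. Qed.

Lemma pochSl a n : poch a n.+1 = a * poch (a + 1) n.
Proof.
rewrite /poch big_ord_recl addr0; congr (_ * _); apply: eq_bigr => i _.
by rewrite lift0 -addrA -natr1 [i%:R + 1]addrC.
Qed.

Lemma poch_gt0 a n : 0 < a -> 0 < poch a n.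
Proof. by move=> a0; apply: prodr_gt0 => i _; rewrite ltr_pwDl. Qed.

Lemma size_rate_poly cs : (size (rate_poly cs) <= (size cs).+1)%N.
Proof.
rewrite /rate_poly; elim: cs => [|c cs IH]; first by rewrite big_nil size_poly1.
rewrite big_cons mulrBl mul1r; apply: leq_trans (size_polyD _ _) _.
rewrite geq_max (leq_trans IH)//= size_polyN -scalerAl.
apply: leq_trans (size_scale_leq _ _) _; rewrite mulrC.
by apply: leq_trans (size_polyMleq _ _) _; rewrite size_polyX addn2.
Qed.

Lemma coef_laguerre a cs i : (laguerre a cs)`_i = (rate_poly cs)`_i / poch (a + 1) i.
Proof.
rewrite coef_poly; case: ifP => // /negbT; rewrite -leqNgt => h.
by rewrite nth_default ?mul0r// (leq_trans (size_rate_poly _)).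
Qed.

Lemma rate_poly0 cs : (rate_poly cs)`_0 = 1.
Proof.
rewrite -horner_coef0 /rate_poly horner_prod big1// => c _.
by rewrite !hornerE subr0.
Qed.

Lemma coef_rate_poly_cons c cs i :
  (rate_poly (c :: cs))`_i = (rate_poly cs)`_i - c * (if i is j.+1 then (rate_poly cs)`_j else 0).
Proof.
rewrite /rate_poly big_cons mulrBl mul1r coefB -scalerAl coefZ coefXM.
by case: i.
Qed.

Lemma pochD a m n : poch a (m + n) = poch a m * poch (a + m%:R) n.
Proof.
elim: n => [|n IH]; first by rewrite addn0 poch0 mulr1.
by rewrite addnS !pochS IH natrD addrA mulrA.
Qed.

Lemma lead_rate_poly_neq0 cs : all (> 0) cs -> (rate_poly cs)`_(size cs) != 0.
Proof.
elim: cs => [|c cs IH] /=.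
  by move=> _; rewrite /rate_poly big_nil coef1 /=; exact: oner_neq0.
move=> /andP[c0 /IH h]; rewrite coef_rate_poly_cons nth_default ?size_rate_poly// sub0r oppr_eq0.
by rewrite mulf_neq0// lt0r_neq0.
Qed.

Lemma size_rate_poly_pos cs : all (> 0) cs -> size (rate_poly cs) = (size cs).+1.
Proof.
move=> c0; apply/eqP; rewrite eqn_leq size_rate_poly ltnNge.
by apply: contra (lead_rate_poly_neq0 c0) => h; rewrite nth_default.
Qed.

End LaguerrePoly.

(** * Zeros of the multiple Laguerre polynomials and their monotonicity in the parameter *)

Section LaguerreRoots.
Variable R : rcfType.
Implicit Types (a b c : R) (cs : seq R).

(* Rodrigues' formula, one factor at a time. *)
Lemma laguerre_cons a c cs : -1 < a ->
  laguerre a (c :: cs) = (a + 1)^-1 *: lag_step (a + 1) c (laguerre (a + 1) cs).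
Proof.
move=> a1; have a0 : 0 < a + 1 by rewrite -ltrBlDr sub0r.
have a0n := lt0r_neq0 a0.
apply/polyP => i; rewrite coefZ /lag_step coefB coefD !coefZ !coefXM coef_deriv.
rewrite !coef_laguerre coef_rate_poly_cons; case: i => [|i].
  by rewrite /= !poch0 rate_poly0; field.
have pn k : poch (a + 1 + 1) k != 0 by rewrite lt0r_neq0// poch_gt0// addr_gt0.
have an : a + 1 + 1 + i%:R != 0 by rewrite lt0r_neq0// ltr_wpDr// addr_gt0.
rewrite [poch (a + 1) i.+1]pochSl pochS /= -[_ *+ i.+1]mulr_natr -natr1.
by field; rewrite a0n pn an.
Qed.

Lemma pos_rootsZ k s n (p : {poly R}) : k != 0 -> pos_roots s n p -> pos_roots s n (k *: p).
Proof.
move=> k0 [p0 pE s0 sl]; split=> //; first by rewrite scaler_eq0 negb_or k0.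
by rewrite lead_coefZ -scalerA -pE.
Qed.

Lemma laguerre_roots cs a : all (> 0) cs -> -1 < a ->
  exists s, pos_roots s (size cs) (laguerre a cs).
Proof.
elim: cs a => [|c cs IH] a /=.
  move=> _ a1; exists (fun=> 0); split=> //.
    apply/eqP => /(congr1 (fun p : {poly R} => p`_0)) /eqP.
    by rewrite coef_laguerre rate_poly0 poch0 divr1 coef0 oner_eq0.
  rewrite big_ord0 alg_polyC; have : (size (laguerre a [::]) <= 1)%N by apply: size_poly.
  by move/size1_polyC => ->; rewrite lead_coefC.
move=> /andP[c0 cs0] a1; have a0 : 0 < a + 1 by rewrite -ltrBlDr sub0r.
have [s rs] := IH _ cs0 (lt_trans (ltrN10 R) a0).
have [s' rs' _] := lag_step_roots a0 c0 rs; exists s'.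
by rewrite laguerre_cons//; apply: pos_rootsZ; rewrite ?invr_eq0 ?lt0r_neq0.
Qed.

Lemma prod_mkseq s n : \prod_(a <- mkseq s n) ('X - a%:P) = \prod_(i < n) ('X - (s i)%:P) :> {poly R}.
Proof. by rewrite /mkseq big_map -[n in iota _ n]subn0 -/(index_iota 0 n) big_mkord. Qed.

Lemma pos_roots_sorted s n (p : {poly R}) : pos_roots s n p -> sorted <%R (mkseq s n).
Proof.
move=> rp; rewrite /mkseq; apply: (@homo_sorted_in _ _ [pred i | i < n]%N _ ltn).
- by move=> i j _ jn ij; apply: (pos_roots_lt rp); exact/andP.
- by apply/allP => i; rewrite mem_iota/= add0n.
- exact: iota_ltn_sorted.
Qed.

(** Carries facts proved for one enumeration of the zeros over to any other: both are the increasing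
    sort of the same multiset. *)
Lemma pos_roots_uniq s z n (p : {poly R}) : pos_roots s n p -> pos_roots z n p ->
  forall i, (i < n)%N -> s i = z i.
Proof.
move=> rs rz i lin; have [p0 pE _ _] := rs; have [_ pE' _ _] := rz.
have /prod_XsubC_eq/perm_mem sz : \prod_(a <- mkseq s n) ('X - a%:P) = \prod_(a <- mkseq z n) ('X - a%:P).
  by apply: (@scalerI _ _ (lead_coef p)); rewrite ?lead_coef_eq0// !prod_mkseq -pE.
rewrite -(nth_mkseq 0 s lin) -(nth_mkseq 0 z lin).
by rewrite (lt_sorted_eq (pos_roots_sorted rs) (pos_roots_sorted rz) sz).
Qed.

(** Two Rodrigues chains are run in parallel. The enumerations are existential because
    [lag_step_mono] also uses the interlacing with the previous level, which comes with those built
    by [lag_step_roots]. *)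
Lemma laguerre_mono_exists cs a b : all (> 0) cs -> -1 < a -> a <= b ->
  exists s z, [/\ pos_roots s (size cs) (laguerre a cs), pos_roots z (size cs) (laguerre b cs) &
    forall i, (i < size cs)%N -> s i <= z i].
Proof.
elim: cs a b => [|c cs IH] a b.
  move=> h a1 ab; have [s rs] := @laguerre_roots [::] a h a1.
  have [z rz] := @laguerre_roots [::] b h (lt_le_trans a1 ab); by exists s, z.
move=> /= /andP[c0 cs0] a1 ab.
have a0 : 0 < a + 1 by rewrite -ltrBlDr sub0r.
have b1 := lt_le_trans a1 ab; have b0 : 0 < b + 1 by rewrite -ltrBlDr sub0r.
have [|s [z [rs rz sz]]] := IH (a + 1) (b + 1) cs0 (lt_trans (ltrN10 R) a0); first by rewrite lerD2r.
have [s' rs' ss'] := lag_step_roots a0 c0 rs; have [z' rz' zz'] := lag_step_roots b0 c0 rz.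
exists s', z'; rewrite !laguerre_cons//; split; try by apply: pos_rootsZ; rewrite ?invr_eq0 ?lt0r_neq0.
apply: (lag_step_mono _ c0 rs rz rs' rz' ss' zz' sz).
by rewrite a0 lerD2r.
Qed.

Lemma laguerre_mono cs a b s z : all (> 0) cs -> -1 < a -> a <= b ->
  pos_roots s (size cs) (laguerre a cs) -> pos_roots z (size cs) (laguerre b cs) ->
  forall i, (i < size cs)%N -> s i <= z i.
Proof.
move=> c0 a1 ab rs rz i iN; have [s' [z' [rs' rz' h]]] := laguerre_mono_exists c0 a1 ab.
by rewrite (pos_roots_uniq rs rs')// (pos_roots_uniq rz rz')// h.
Qed.

End LaguerreRoots.

(** * Grace's theorem in a half-plane and the classical Laguerre pair *)

Section Grace.
Variable C : numClosedFieldType.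
Implicit Types (z w c a b k : C) (f g : {poly C}).

(* Laguerre's polar derivative of [f], seen as a polynomial of degree [n]. *)
Definition polar n c f : {poly C} := n%:R *: f + (c%:P - 'X) * f^`().

Lemma coef_polar n c f i : (polar n c f)`_i = (n%:R - i%:R) * f`_i + c * (i.+1%:R * f`_i.+1).
Proof.
rewrite /polar coefD coefZ.
rewrite [X in X * f^`()]addrC mulrDl mulNr.
rewrite coefD coefN coefCM coefXM.
rewrite !coef_deriv.
rewrite -[f`_i.+1 *+ _]mulr_natl.
case: i => [|i] /=.
 ring.
rewrite -[f`_i.+1 *+ _]mulr_natl.
ring.
Qed.

(* The constant polynomial [polarize s f] is, up to the factor [(size s)`!],
   the symmetric multi-affine polarization of [f] evaluated at [s]. *)
Fixpoint polarize (s : seq C) f : {poly C} :=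
  if s is c :: s' then polarize s' (polar (size s) c f) else f.

(** The exact degree excludes zeros at infinity, which [polar] with formal degree [n] would
    count. *)
Definition stable n f := size f = n.+1 /\ forall z, 0 <= 'Im z -> ~~ root f z.

Lemma ImV z : 'Im (z^-1) = - ('Im z * `|z^-1| ^+ 2).
Proof.
rewrite [X in 'Im X]invC_norm normfV -exprVn ImMl ?rpredX ?rpredV ?normr_real//.
by rewrite Im_conj mulrN mulrC.
Qed.

(** The variance of the values [F x], whose mean is [c], is nonnegative. This is the Jensen
    inequality behind [stable_polar]. *)
Lemma sum_normC_sub (s : seq C) (F : C -> C) c :
  \sum_(x <- s) F x = (size s)%:R * c ->
  (size s)%:R * `|c| ^+ 2 <= \sum_(x <- s) `|F x| ^+ 2.
Proof.
move=> h; have h' : \sum_(x <- s) (F x)^* = (size s)%:R * c^*.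
  by rewrite -rmorph_sum h rmorphM/= rmorph_nat.
have : 0 <= \sum_(x <- s) `|F x - c| ^+ 2 by apply: sumr_ge0 => x _; rewrite exprn_ge0.
have -> : \sum_(x <- s) `|F x - c| ^+ 2 =
    \sum_(x <- s) `|F x| ^+ 2 - (\sum_(x <- s) F x) * c^* - c * (\sum_(x <- s) (F x)^*)
    + (size s)%:R * `|c| ^+ 2.
  elim: s {h h'} => [|x s IH]; first by rewrite !big_nil /=; ring.
  by rewrite !big_cons IH/= -natr1 !normCK rmorphB/=; ring.
rewrite h h' normCK (_ : _ - _ - _ + _ = \sum_(x <- s) `|F x| ^+ 2 - (size s)%:R * (c * c^* )).
  by rewrite subr_ge0.
by ring.
Qed.

Lemma sumr_seq_gt0 (s : seq C) (F : C -> C) : (0 < size s)%N ->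
  {in s, forall x, 0 < F x} -> 0 < \sum_(x <- s) F x.
Proof.
case: s => // y s _ F0; rewrite big_cons ltr_pwDl ?F0 ?mem_head//.
by rewrite big_seq; apply: sumr_ge0 => x xs; rewrite ltW// F0// in_cons xs orbT.
Qed.

(* For [h w = 'Im z * `|w| ^+ 2 + 'Im w], which is convex, [h ((z - x)^-1)] has
   the sign of ['Im x]: it is negative at the roots of [f] and nonnegative at [c],
   so [(z - c)^-1] is not the mean of the [(z - x)^-1]. *)
Lemma stable_polar n c f : 0 <= 'Im c -> stable n.+1 f -> stable n (polar n.+1 c f).
Proof.
move=> c0 [sf fst]; have f0 : f != 0 by rewrite -size_poly_eq0 sf.
have [s fE] := closed_field_poly_normal f.
have l0 : lead_coef f != 0 by rewrite lead_coef_eq0.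
have ss : size s = n.+1 by move: sf; rewrite fE size_scale// size_prod_XsubC => -[].
have rs x : x \in s -> 'Im x < 0.
  move=> xs; have : root f x by rewrite fE rootZ// root_prod_XsubC.
  apply: contraTT; rewrite -real_leNgt ?Creal_Im ?real0// => /fst.
  exact.
have size_g : (size (polar n.+1 c f) <= n.+1)%N.
  apply/leq_sizeP => j; rewrite leq_eqVlt => /orP[/eqP<-|nj]; rewrite coef_polar.
    by rewrite subrr mul0r add0r nth_default ?mulr0 ?sf.
  by rewrite !nth_default ?mulr0 ?addr0// sf// ltnW.
(* This coefficient is [lead_coef f] times the sum of the [c - x], whose imaginary parts are all
   positive, so the degree drops by exactly one. *)
have coef_n : (polar n.+1 c f)`_n != 0.
  rewrite coef_polar -natr1 addrAC subrr add0r mul1r.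
  have -> : f`_n.+1 = lead_coef f by rewrite lead_coefE sf.
  have -> : f`_n = - (lead_coef f * \sum_(x <- s) x).
    have := @coefPn_prod_XsubC _ s; rewrite ss => /(_ isT) h.
    by rewrite fE lead_coefZ coefZ lead_coef_prod_XsubC mulr1 h mulrN.
  have -> : - (lead_coef f * \sum_(x <- s) x) + c * ((n%:R + 1) * lead_coef f) =
     lead_coef f * (\sum_(x <- s) (c - x)).
    have -> : \sum_(x <- s) (c - x) = (n%:R + 1) * c - \sum_(x <- s) x.
      by rewrite sumrB; congr (_ - _); rewrite big_const_seq count_predT ss iter_addr_0 -[_ *+ n.+1]mulr_natl natr1.
    ring.
  rewrite mulf_neq0//; apply/negP => /eqP h.
  have : 0 < 'Im (\sum_(x <- s) (c - x)).
    rewrite raddf_sum sumr_seq_gt0 ?ss// => x /rs xs.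
    by rewrite raddfB/= subr_gt0 (lt_le_trans xs).
  by rewrite h raddf0 ltxx.
split.
  apply/eqP; rewrite eqn_leq size_g ltnNge; apply: contra coef_n => h.
  by rewrite nth_default.
move=> z z0; apply/negP => /rootP.
have zs x : x \in s -> z - x != 0.
  by move=> /rs xz; rewrite subr_eq0; apply: contraTneq z0 => ->; rewrite -real_ltNge ?Creal_Im ?real0.
have fz : f.[z] != 0 by have := fst z z0; rewrite /root.
have f'z : f^`().[z] = f.[z] * \sum_(x <- s) (z - x)^-1.
  rewrite fE derivZ !hornerZ -mulrA -horner_deriv_prod_XsubC//.
  by apply/negP => /zs; rewrite subrr eqxx.
rewrite /polar hornerD hornerZ hornerM hornerD hornerN hornerC hornerX f'z.
set S := \sum_(x <- s) _ => H.
have {}H : n.+1%:R = (z - c) * S.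
  by apply: (mulIf fz); apply/eqP; rewrite -subr_eq0; apply/eqP; rewrite -[RHS]H; ring.
have zc : z - c != 0 by apply/negP => /eqP zc; move/eqP: H; rewrite zc mul0r pnatr_eq0.
have Sd : S = (size s)%:R * (z - c)^-1 by rewrite ss H mulrAC mulfV ?mul1r.
have := sum_normC_sub Sd => q.
have ImS : 'Im S = (size s)%:R * 'Im ((z - c)^-1) by rewrite Sd ImMl ?realn.
(* Jensen: the sum of the [h ((z - x)^-1)] is at least [size s] times [h ((z - c)^-1)], which is
   nonnegative since [0 <= 'Im c]. *)
have : 0 <= 'Im z * (\sum_(x <- s) `|(z - x)^-1| ^+ 2) + 'Im S.
  apply: le_trans (lerD (ler_wpM2l z0 q) (lexx _)).
  rewrite ImS ImV raddfB/=; set D := `|_| ^+ 2.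
  rewrite (_ : _ + _ = (size s)%:R * D * 'Im c); last by ring.
  by rewrite !mulr_ge0// exprn_ge0.
have -> : 'Im z * (\sum_(x <- s) `|(z - x)^-1| ^+ 2) + 'Im S =
    - \sum_(x <- s) (`|(z - x)^-1| ^+ 2 * - 'Im x).
  rewrite mulr_sumr /S raddf_sum -big_split/= -sumrN; apply: eq_bigr => x _.
  by rewrite ImV raddfB/=; ring.
rewrite oppr_ge0 real_leNgt ?real0//; last first.
  by apply: rpred_sum => x _; rewrite rpredM ?rpredN ?Creal_Im ?rpredX ?normr_real.
rewrite sumr_seq_gt0 ?ss// => x xs; rewrite mulr_gt0 ?oppr_gt0 ?rs//.
by rewrite exprn_gt0// normr_gt0 invr_eq0 zs.
Qed.

(** The half-plane case of Grace's theorem: every polar derivative preserves stability and lowers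
    the degree by one, so what remains at the end is a nonzero constant. *)
Lemma stable_polarize s f : all (fun c => 0 <= 'Im c) s -> stable (size s) f ->
  (polarize s f)`_0 != 0.
Proof.
elim: s f => [|c s IH] f /=; last first.
  by move=> /andP[c0 s0] fs; apply: IH s0 _; exact: stable_polar.
move=> _ [sf _]; have f0 : f != 0 by rewrite -size_poly_eq0 sf.
by move: f0; rewrite -lead_coef_eq0 lead_coefE sf.
Qed.

(** Up to an overall factorial, polarization replaces [x^i] by the [i]-th elementary symmetric
    function of the points over [binomial(size cs, i)]; at the points [c * z] that function is the
    [i]-th coefficient of [rate_poly cs] times [(- z)^i]. *)
Lemma polarizeE cs f z : (size f <= (size cs).+1)%N ->
  (polarize [seq c * z | c <- cs] f)`_0 =
  \sum_(i < (size cs).+1) f`_i * (i`! * (size cs - i)`!)%:R * (rate_poly cs)`_i * (- z) ^+ i.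
Proof.
elim: cs f => [|c cs IH] f sf /=.
  by rewrite big_ord1 /= rate_poly0 !mulr1.
rewrite IH; last first.
  apply/leq_sizeP => j nj; rewrite coef_polar size_map.
  move: nj; rewrite leq_eqVlt => /orP[/eqP<-|nj].
    by rewrite subrr mul0r add0r [f`_ _]nth_default ?mulr0.
  by rewrite !nth_default ?mulr0 ?addr0// (leq_trans sf)// ltnW.
set n := size cs in sf *; rewrite size_map -/n.
have rn : (rate_poly cs)`_n.+1 = 0 by rewrite nth_default ?size_rate_poly.
(* The two terms of [coef_polar] match those of the recurrence
   [e_i(c, cs) = e_i(cs) + c * e_(i-1)(cs)] for the elementary symmetric functions. *)
rewrite (eq_bigr (fun i : 'I_n.+1 => f`_i * (i`! * (n.+1 - i)`!)%:R * (rate_poly cs)`_i * (- z) ^+ i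
    + f`_i.+1 * (i.+1`! * (n - i)`!)%:R * (c * z * (rate_poly cs)`_i) * (- z) ^+ i)); last first.
  move=> i _; have in1 : (i <= n)%N by rewrite -ltnS.
  rewrite coef_polar subSn// !factS !natrM -subSn// natrB ?leqW//; ring.
under [RHS]eq_bigr do rewrite coef_rate_poly_cons mulrBr mulrBl.
rewrite !big_split/=; congr (_ + _).
  by rewrite [RHS]big_ord_recr/= rn mulr0 mul0r addr0.
rewrite [RHS]big_ord_recl/= mulr0 mulr0 mul0r oppr0 add0r; apply: eq_bigr => i _.
rewrite /bump/= ?add1n subSS exprS; ring.
Qed.

Lemma coef_rate_poly_nseq n i : (rate_poly (nseq n 1))`_i = (-1) ^+ i * ('C(n, i))%:R :> C.
Proof.
elim: n i => [|n IH] i.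
  rewrite /rate_poly big_nil coef1 bin0n; case: i => [|i] /=; first by rewrite mulr1.
  by rewrite mulr0.
rewrite coef_rate_poly_cons mul1r; case: i => [|i]; first by rewrite IH !bin0 subr0.
by rewrite !IH binS natrD exprS; ring.
Qed.

(** For rates all equal to 1 the [i]-th coefficient carries [(-1)^i * binomial(n, i)], which cancels
    the binomial and the sign introduced by polarization and leaves the multiple polynomial. *)
Lemma polarize_laguerre cs a b k z : let n := size cs in
  (polarize [seq c * z | c <- cs] (laguerre a (nseq n 1) + k *: laguerre b (nseq n 1)))`_0 =
  n`!%:R * ((laguerre a cs).[z] + k * (laguerre b cs).[z]).
Proof.
move=> n; have sl (d : C) : (size (laguerre d (nseq n 1%R)) <= n.+1)%N.
  by rewrite /laguerre size_nseq size_poly.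
rewrite polarizeE; last first.
  apply: leq_trans (size_polyD _ _) _; rewrite geq_max sl (leq_trans (size_scale_leq _ _))//.
rewrite -/n /laguerre !horner_poly -/n mulr_sumr -big_split/= mulr_sumr; apply: eq_bigr => i _.
have in1 : (i <= n)%N by rewrite -ltnS.
rewrite -/(laguerre a _) -/(laguerre b _) coefD coefZ !coef_laguerre !coef_rate_poly_nseq.
rewrite -(bin_fact in1) !natrM [(- z) ^+ i]exprNn; set e := (-1) ^+ i.
have e2 : e * e = 1 by rewrite -expr2 sqrr_sign.
transitivity ((e * e) * ('C(n, i))%:R * (i`!%:R * (n - i)`!%:R) *
  ((rate_poly cs)`_i / poch (a + 1) i * z ^+ i +
   k * ((rate_poly cs)`_i / poch (b + 1) i * z ^+ i))); first by ring.
by rewrite e2; ring.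
Qed.

Lemma coef_mulX_deriv f i : ('X * f^`())`_i = i%:R * f`_i.
Proof. by rewrite coefXM coef_deriv; case: i => [|i] /=; rewrite ?mul0r// mulr_natl. Qed.

(** The operator [a + 1 + x d/dx] multiplies the [i]-th coefficient by [a + 1 + i], and [(a + 1) *
    (a + 2)_i = (a + 1)_i * (a + 1 + i)]. *)
Lemma laguerre_shift_theta a cs : -1 < a ->
  (a + 1) *: laguerre a cs = (a + 1) *: laguerre (a + 1) cs + 'X * (laguerre (a + 1) cs)^`().
Proof.
move=> a1; have a0 : 0 < a + 1 by rewrite -ltrBlDr sub0r.
apply/polyP => i; rewrite coefD !coefZ coef_mulX_deriv !coef_laguerre.
have p1 := lt0r_neq0 (poch_gt0 i a0).
have p2 : poch (a + 1 + 1) i != 0 := lt0r_neq0 (poch_gt0 i (addr_gt0 a0 ltr01)).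
have h : (a + 1) * poch (a + 1 + 1) i = poch (a + 1) i * (a + 1 + i%:R) by rewrite -pochSl pochS.
rewrite -mulrDl (_ : a + 1 + i%:R = (a + 1) * poch (a + 1 + 1) i / poch (a + 1) i).
  by field; rewrite p1 p2.
by rewrite h; field.
Qed.

(** From [(i + 1) * binomial(n, i + 1) = (n - i) * binomial(n, i)], the [i]-th coefficient of the
    difference is that of [laguerre a (nseq n 1)] times [(n + a + 1) / (a + 1 + i)]. *)
Lemma laguerre_shift_deriv a n : -1 < a ->
  (a + 1) *: (laguerre a (nseq n 1) - (laguerre a (nseq n 1))^`()) =
  (n%:R + a + 1) *: laguerre (a + 1) (nseq n 1).
Proof.
move=> a1; have a0 : 0 < a + 1 by rewrite -ltrBlDr sub0r.
apply/polyP => i; rewrite !coefZ coefB coef_deriv -[_ *+ i.+1]mulr_natl !coef_laguerre !coef_rate_poly_nseq.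
have binE : i.+1%:R * ('C(n, i.+1))%:R = (n%:R - i%:R) * ('C(n, i))%:R :> C.
  have [lin|gin] := leqP i n; last by rewrite !bin_small ?mulr0// ltnW.
  by rewrite -natrM mul_bin_left natrM natrB.
have p1 := lt0r_neq0 (poch_gt0 i a0).
have p2 : poch (a + 1 + 1) i != 0 := lt0r_neq0 (poch_gt0 i (addr_gt0 a0 ltr01)).
have h : (a + 1) * poch (a + 1 + 1) i = poch (a + 1) i * (a + 1 + i%:R) by rewrite -pochSl pochS.
have ai : a + 1 + i%:R != 0 by rewrite lt0r_neq0// ltr_wpDr.
rewrite pochS exprS; set e := (-1) ^+ i.
rewrite (_ : i.+1%:R * (-1 * e * 'C(n, i.+1)%:R / (poch (a + 1) i * (a + 1 + i%:R))) =
  - e * (i.+1%:R * ('C(n, i.+1))%:R) / (poch (a + 1) i * (a + 1 + i%:R))); last by ring.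
rewrite binE (_ : a + 1 + i%:R = (a + 1) * poch (a + 1 + 1) i / poch (a + 1) i); last first.
  by rewrite h; field.
have nz : poch (a + 1) i * (a + 1 + i%:R) != 0 by rewrite mulf_neq0.
have -> : poch (a + 1 + 1) i = poch (a + 1) i * (a + 1 + i%:R) / (a + 1).
  by rewrite -h; field; rewrite lt0r_neq0.
by field; rewrite (lt0r_neq0 a0) p1 ai.
Qed.

Lemma lead_laguerre_neq0 a cs : -1 < a -> all (> 0) cs -> (laguerre a cs)`_(size cs) != 0.
Proof.
move=> a1 c0; have a0 : 0 < a + 1 by rewrite -ltrBlDr sub0r.
by rewrite coef_laguerre mulf_neq0 ?lead_rate_poly_neq0// invr_eq0 lt0r_neq0// poch_gt0.
Qed.

(* With [f] the polynomial of parameter [a + 1] and [L = f' / f], the two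
   polynomials are positive multiples of [f * (a + 1 + z * L)] and [f * (1 - L)]. *)
Lemma stable_laguerre_pair a n (s : seq C) : -1 < a -> (0 < n)%N ->
  uniq s -> all (> 0) s ->
  laguerre (a + 1) (nseq n 1) =
    lead_coef (laguerre (a + 1) (nseq n 1)) *: \prod_(x <- s) ('X - x%:P) ->
  stable n (laguerre a (nseq n 1) - 'i *: laguerre (a + 1 + 1) (nseq n 1)).
Proof.
move=> a1 n0 us /allP s0; set f := laguerre (a + 1) _ => fE.
have a0 : 0 < a + 1 by rewrite -ltrBlDr sub0r.
have a2 : -1 < a + 1 by apply: lt_trans a0; rewrite ltrN10.
have a4 : 0 < a + 1 + 1 by rewrite addr_gt0.
have ar : a + 1 \is Num.real by rewrite gtr0_real.
have fn : f`_n != 0.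
  have := @lead_laguerre_neq0 (a + 1) (nseq n 1) a2; rewrite size_nseq; apply.
  by apply/allP => x /nseqP[-> _]; exact: ltr01.
have f0 : f != 0 by apply: contraNneq fn => ->; rewrite coef0.
have l0 : lead_coef f != 0 by rewrite lead_coef_eq0.
set H := _ - _.
have HE : (a + 1) *: H = ((a + 1) *: f + 'X * f^`()) -
    ('i * (a + 1) * (a + 1 + 1) / (n%:R + (a + 1) + 1)) *: (f - f^`()).
  rewrite /H scalerBr laguerre_shift_theta// -/f; congr (_ - _).
  have n1 : n%:R + (a + 1) + 1 != 0 by rewrite lt0r_neq0// addr_gt0// ltr_wpDl.
  rewrite mulrAC -[RHS]scalerA laguerre_shift_deriv// !scalerA; congr (_ *: _).
  by field.
have size_l (d : C) : (size (laguerre d (nseq n 1%R)) <= n.+1)%N.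
  by rewrite /laguerre size_nseq size_poly.
have size_eq (g : {poly C}) : (size g <= n.+1)%N -> g`_n != 0 -> size g = n.+1.
  move=> gn gn0; apply/eqP; rewrite eqn_leq gn ltnNge; apply: contra gn0 => h.
  by rewrite nth_default.
have size_f : size f = n.+1 by apply: size_eq (size_l _) fn.
have ss : size s = n by move: size_f; rewrite fE size_scale// size_prod_XsubC => -[].
split.
  apply: size_eq.
    apply: leq_trans (size_polyD _ _) _; rewrite geq_max size_l size_polyN.
    by apply: leq_trans (size_scale_leq _ _) _.
  (* Up to a nonzero factor the leading coefficient is [x - i y] with [x] and [y] positive reals. *)
  rewrite /H coefB coefZ !coef_laguerre !coef_rate_poly_nseq binn mulr1.
  rewrite mulrCA -mulrBr mulf_neq0 ?signr_eq0//.
  set x := (poch (a + 1) n)^-1; set y := (poch _ n)^-1.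
  have x0 : 0 < x by rewrite invr_gt0 poch_gt0.
  have y0 : 0 < y by rewrite invr_gt0 poch_gt0// addr_gt0.
  apply/negP => /eqP/(congr1 (@Im C)); rewrite raddfB/= ImMr ?gtr0_real// Im_i mul1r raddf0.
  rewrite (Creal_ImP _ (gtr0_real x0)) sub0r => /eqP; rewrite oppr_eq0.
  by rewrite (negbTE (lt0r_neq0 y0)).
move=> z z0; apply/negP => /rootP Hz.
have {HE}Hz : ((a + 1) * f.[z] + z * f^`().[z]) =
    'i * ((a + 1) * (a + 1 + 1) / (n%:R + (a + 1) + 1)) * (f.[z] - f^`().[z]).
  have := congr1 (horner^~ z) HE; rewrite /= hornerZ Hz mulr0 !(hornerD, hornerN, hornerZ, hornerM, hornerX) => h.
  apply/eqP; rewrite -subr_eq0 h; apply/eqP; ring.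
set k := _ / _ in Hz; have k0 : 0 < k.
  by rewrite divr_gt0 ?mulr_gt0// addr_gt0// ltr_wpDl.
clearbody k.
(* At a zero of [f] the equation forces [z = - i k], which is not a positive real. *)
have [zs|zs] := boolP (z \in s).
  have fz : f.[z] = 0 by rewrite fE hornerZ; apply/eqP; rewrite mulf_eq0 -rootE root_prod_XsubC zs orbT.
  have f'z : f^`().[z] != 0.
    rewrite fE (big_rem z)//= derivZ hornerZ derivM derivXsubC mul1r hornerD hornerM hornerXsubC.
    rewrite subrr mul0r addr0 mulf_neq0// -rootE root_prod_XsubC.
    by rewrite mem_rem_uniq// inE eqxx.
  move: Hz; rewrite fz mulr0 add0r sub0r mulrN => Hz.
  have : z = - ('i * k) by apply: (mulIf f'z); rewrite Hz mulNr.
  move/(congr1 (@Re C)); rewrite raddfN/= ReMr ?gtr0_real// Re_i mul0r oppr0.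
  rewrite (Creal_ReP _ (gtr0_real (s0 z zs))) => zz0.
  by have := s0 z zs; rewrite zz0 ltxx.
have zx x : x \in s -> z - x != 0.
  by move=> xs; rewrite subr_eq0; apply: contraNneq zs => ->.
have fz : f.[z] != 0.
  by rewrite fE hornerZ mulf_neq0// -rootE root_prod_XsubC.
have f'z : f^`().[z] = f.[z] * \sum_(x <- s) (z - x)^-1.
  by rewrite [in LHS]fE [in RHS]fE derivZ !hornerZ -mulrA -horner_deriv_prod_XsubC.
set L := \sum_(x <- s) _ in f'z.
have {}Hz : (a + 1) + z * L = 'i * k * (1 - L).
  apply: (mulIf fz); transitivity ((a + 1) * f.[z] + z * f^`().[z]); first by rewrite f'z; ring.
  by rewrite Hz f'z; ring.
pose q x := `|(z - x)^-1| ^+ 2.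
have q0 x : x \in s -> 0 < q x by move=> xs; rewrite exprn_gt0// normr_gt0 invr_eq0 zx.
have ImL : 'Im L = - ('Im z * \sum_(x <- s) q x).
  rewrite /L raddf_sum mulr_sumr -sumrN big_seq [RHS]big_seq; apply: eq_bigr => x xs.
  by rewrite /= ImV raddfB/= (Creal_ImP _ (gtr0_real (s0 x xs))) subr0.
have ImzL : 'Im (z * L) = - ('Im z * \sum_(x <- s) x * q x).
  have -> : z * L = n%:R + \sum_(x <- s) x * (z - x)^-1.
    rewrite -ss -sum1_size natr_sum -big_split/= mulr_sumr big_seq [RHS]big_seq.
    by apply: eq_bigr => x /zx xz; field.
  rewrite raddfD/= (Creal_ImP _ (realn C n)) add0r raddf_sum mulr_sumr -sumrN big_seq [RHS]big_seq.
  apply: eq_bigr => x xs; rewrite /= ImMl ?gtr0_real ?s0//= ImV raddfB/=.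
  by rewrite (Creal_ImP _ (gtr0_real (s0 x xs))) subr0 mulrN mulrCA.
(* After multiplication by the conjugate of [1 - L], the right side has imaginary part
   [k * |1 - L|^2] and the left side [- 'Im z * B] with [B > 0], so that both vanish and [L = 1]. *)
have : 'Im ((a + 1 + z * L) * (1 - L)^*) = k * `|1 - L| ^+ 2.
  rewrite Hz -mulrA -normCK -mulrA ImMr ?Im_i ?mul1r//.
  by rewrite rpredM ?rpredX ?normr_real ?(gtr0_real k0).
have -> : (a + 1 + z * L) * (1 - L)^* = a + 1 + z * L - z * `|L| ^+ 2 - (a + 1) * L^*.
  by rewrite normCK rmorphB rmorph1; ring.
have e1 : 'Im (z * `|L| ^+ 2) = 'Im z * `|L| ^+ 2 by rewrite ImMr ?rpredX ?normr_real.
have e2 : 'Im ((a + 1) * L^*) = - ((a + 1) * 'Im L) by rewrite ImMl// Im_conj mulrN.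
have e3 : 'Im (a + 1) = 0 by apply/Creal_ImP.
rewrite 2!raddfB (raddfD _ (a + 1))/= e1 e2 e3 ImL ImzL => E.
have Sq : 0 < \sum_(x <- s) q x by apply: sumr_seq_gt0; rewrite ?ss.
have Sxq : 0 < \sum_(x <- s) x * q x.
  apply: sumr_seq_gt0; rewrite ?ss// => x xs; apply: mulr_gt0; [exact: s0|exact: q0].
pose B := \sum_(x <- s) x * q x + `|L| ^+ 2 + (a + 1) * \sum_(x <- s) q x.
have B0 : 0 < B by rewrite ltr_pwDr ?mulr_gt0// addr_ge0 ?exprn_ge0// ltW.
have /eqP : 'Im z * B + k * `|1 - L| ^+ 2 = 0 by rewrite -E /B; ring.
rewrite paddr_eq0 ?mulr_ge0 ?exprn_ge0 ?(ltW B0) ?(ltW k0)//.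
rewrite !mulf_eq0 (negbTE (lt0r_neq0 B0)) (negbTE (lt0r_neq0 k0)) orbF/=.
rewrite orbb normr_eq0 subr_eq0 [1 == L]eq_sym => /andP[_ /eqP L1].
(* With [L = 1] the equation reads [z = - (a + 1)], and then every [(z - x)^-1] is negative, against
   [L = 1]. *)
move/eqP: Hz; rewrite L1 subrr mulr0 mulr1 addr_eq0 eq_sym eqr_oppLR => /eqP zE.
have : 0 < - L.
  rewrite /L -sumrN sumr_seq_gt0 ?ss// => x xs.
  rewrite oppr_gt0 invr_lt0 zE -opprD oppr_lt0.
  by rewrite addr_gt0// s0.
by rewrite L1 oppr_gt0 ltr10.
Qed.

(** The product is [|H(x)|^2 * H'(x) / H(x)], and [H' / H] is the sum of the [(x - y)^-1] over zeros
    [y] in the lower half-plane, each term of negative imaginary part as [x] is real. *)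
Lemma Im_logderiv_lt0 (H : {poly C}) (x : C) : (1 < size H)%N ->
  (forall z, 0 <= 'Im z -> ~~ root H z) -> 'Im x = 0 ->
  'Im (H^`().[x] * (H.[x])^* ) < 0.
Proof.
move=> sH nr Imx; have H0 : H != 0 by rewrite -size_poly_gt0 ltnW.
have [s sE] := closed_field_poly_normal H.
have ss : (0 < size s)%N by move: sH; rewrite sE size_scale ?lead_coef_eq0// size_prod_XsubC ltnS.
have rs y : y \in s -> 'Im y < 0.
  move=> ys; have : root H y by rewrite sE rootZ ?lead_coef_eq0// root_prod_XsubC.
  by apply: contraTT; rewrite -real_leNgt ?Creal_Im ?real0// => /nr.
have Hx : H.[x] != 0 by have := nr x; rewrite Imx lexx /root => ->.
have xs : x \notin s by apply/negP => /rs; rewrite Imx ltxx.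
have H'x : H^`().[x] = H.[x] * \sum_(y <- s) (x - y)^-1.
  by rewrite [in LHS]sE [in RHS]sE derivZ !hornerZ -mulrA -horner_deriv_prod_XsubC.
rewrite H'x mulrAC -normCK ImMl ?rpredX ?normr_real//.
rewrite pmulr_rlt0 ?exprn_gt0 ?normr_gt0// raddf_sum -oppr_gt0 -sumrN.
apply: sumr_seq_gt0 => // y ys /=; rewrite ImV opprK raddfB/= Imx sub0r.
rewrite mulr_gt0 ?oppr_gt0 ?rs// exprn_gt0// normr_gt0 invr_eq0 subr_eq0.
by apply: contraNneq xs => ->.
Qed.

End Grace.

From mathcomp Require Import complex.

(** * Hermite-Biehler and the comparison of the parameters [a] and [a + 2] *)

Section Wronskian.
Variable R : rcfType.
Notation C := (complex R).
Notation phi := (real_complex R).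
Implicit Types (a : R) (cs : seq R) (u v : {poly R}).

Lemma real_complex_real (x : R) : phi x \is Num.real.
Proof. by rewrite realE -(rmorph0 phi) !lecR le_total. Qed.

Lemma map_rate_poly cs : map_poly phi (rate_poly cs) = rate_poly (map phi cs).
Proof.
rewrite /rate_poly rmorph_prod big_map; apply: eq_bigr => c _.
by rewrite rmorphB rmorph1 /= linearZ_LR/= map_polyX.
Qed.

Lemma map_laguerre a cs : map_poly phi (laguerre a cs) = laguerre (phi a) (map phi cs).
Proof.
apply/polyP => i; rewrite coef_map/= !coef_laguerre fmorph_div -map_rate_poly coef_map/=.
congr (_ / _); rewrite /poch rmorph_prod; apply: eq_bigr => j _.
by rewrite !rmorphD/= rmorph1 rmorph_nat.
Qed.

(* Hermite-Biehler: the hypothesis says that [u - i v] has all its zeros in the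
   open lower half-plane. *)
Lemma wronskian_lt0 u v : (1 < size u)%N ->
  (forall z : C, 0 <= 'Im z -> (map_poly phi u).[z] - 'i * (map_poly phi v).[z] != 0) ->
  forall x, u^`().[x] * v.[x] - u.[x] * v^`().[x] < 0.
Proof.
move=> su nr x; pose H := map_poly phi u - 'i *: map_poly phi v.
have HE z : H.[z] = (map_poly phi u).[z] - 'i * (map_poly phi v).[z].
  by rewrite /H hornerD hornerN hornerZ.
have coefH i : H`_i = 0 -> u`_i = 0.
  rewrite /H coefB coefZ !coef_map/= => /(congr1 (fun y : C => 'Re y)) /=.
  rewrite raddfB/= ReMr ?real_complex_real// Re_i mul0r subr0 raddf0.
  by rewrite (Creal_ReP _ (real_complex_real _)) => /eqP; rewrite fmorph_eq0 => /eqP.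
have sH : (1 < size H)%N.
  rewrite ltnNge; apply/negP => h.
  have : u`_(size u).-1 != 0 by rewrite -lead_coefE lead_coef_eq0 -size_poly_gt0 ltnW.
  rewrite (coefH _ _) ?eqxx//; apply: nth_default.
  by apply: (leq_trans h); rewrite -ltnS prednK// ltnW.
have ImHH : 'Im (H^`().[phi x] * (H.[phi x])^*) = phi (u^`().[x] * v.[x] - u.[x] * v^`().[x]).
  rewrite /H derivB derivZ !deriv_map !(hornerD, hornerN, hornerZ) !horner_map/=.
  rewrite rmorphB/= rmorphM/= conjCi.
  rewrite !(conj_Creal (real_complex_real _)).
  rewrite (_ : _ * _ = phi (u^`().[x] * u.[x] + v^`().[x] * v.[x]) + 'i * phi (u^`().[x] * v.[x] - u.[x] * v^`().[x])).
    by rewrite Im_rect ?real_complex_real.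
  rewrite !(rmorphB, rmorphD, rmorphM)/=.
  set U' := phi u^`().[x]; set V' := phi v^`().[x]; set U := phi u.[x]; set V := phi v.[x].
  transitivity (U' * U - ('i * 'i) * (V' * V) + 'i * (U' * V - U * V') : C); first by ring.
  by rewrite mulCii; ring.
rewrite -ltcR -ImHH; apply: Im_logderiv_lt0 => // [z z0|].
  by rewrite /root HE nr.
by apply/Creal_ImP; exact: real_complex_real.
Qed.

(** Grace's theorem transfers the nonvanishing from rates all equal to 1 to general ones, the points
    [c * z] staying in the closed upper half-plane as [c > 0]. *)
Lemma laguerre_pair_neq0 a cs (z : C) : -1 < a -> all (> 0) cs -> (0 < size cs)%N -> 0 <= 'Im z ->
  (map_poly phi (laguerre a cs)).[z] - 'i * (map_poly phi (laguerre (a + 1 + 1) cs)).[z] != 0.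
Proof.
move=> a1 c0 n0 z0; have a0 : 0 < a + 1 by rewrite -ltrBlDr sub0r.
have pa : -1 < phi a by rewrite -(rmorphN1 phi) ltcR.
have pc : all (> 0) (map phi cs).
  by apply/allP => _ /mapP[c /(allP c0) h ->]; rewrite -(rmorph0 phi) ltcR.
have [|s rs] := @laguerre_roots R (nseq (size cs) 1) (a + 1) _ (lt_trans (ltrN10 R) a0).
  by apply/allP => x /nseqP[-> _]; exact: ltr01.
rewrite size_nseq in rs; have [p0 pE s0 _] := rs.
have mapn m : map phi (nseq m 1) = nseq m 1 by rewrite map_nseq rmorph1.
have st : stable (size cs) (laguerre (phi a) (nseq (size cs) 1) - 'i *: laguerre (phi a + 1 + 1) (nseq (size cs) 1)).
  apply: (@stable_laguerre_pair _ _ _ [seq phi (s i) | i <- index_iota 0 (size cs)]) => //.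
  - rewrite map_inj_in_uniq ?iota_uniq// => i j; rewrite !mem_index_iota/= => iN jN /complexI sij.
    case: (ltngtP i j) => // ij.
      by have := pos_roots_lt rs (introT andP (conj ij jN)); rewrite sij ltxx.
    by have := pos_roots_lt rs (introT andP (conj ij iN)); rewrite sij ltxx.
  - apply/allP => y /mapP[j]; rewrite mem_index_iota/= => jN ->.
    by rewrite -(rmorph0 phi) ltcR s0.
  - have := congr1 (map_poly phi) pE; rewrite map_polyZ rmorph_prod/= -lead_coef_map map_laguerre mapn.
    rewrite rmorphD/= rmorph1 big_map big_mkord => {1}->; congr (_ *: _).
    by apply: eq_bigr => i _; rewrite map_polyXsubC.
have pos : all (fun c => 0 <= 'Im c) [seq c * z | c <- map phi cs].
  apply/allP => _ /mapP[c /(allP pc) h ->]; rewrite ImMl ?gtr0_real//.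
  by rewrite mulr_ge0 ?(ltW h).
have := stable_polarize pos; rewrite !size_map => /(_ _ st).
rewrite -scaleNr -{1 2}(size_map phi cs) polarize_laguerre !map_laguerre !rmorphD/= rmorph1.
by rewrite mulf_eq0 negb_or mulNr => /andP[].
Qed.

(** At a zero of [u] the Wronskian reduces to [u' * v], so [v] has the sign opposite to [u'], which
    alternates. With a point [M] beyond all zeros, each gap holds one zero of [v]. *)
Lemma laguerre_roots_next a cs s z i : -1 < a -> all (> 0) cs ->
  pos_roots s (size cs) (laguerre a cs) -> pos_roots z (size cs) (laguerre (a + 1 + 1) cs) ->
  (i.+1 < size cs)%N -> z i < s i.+1.
Proof.
set u := laguerre a cs; set v := laguerre (a + 1 + 1) cs; set n := size cs.
move=> a1 c0 ru rv iN; have n0 : (0 < n)%N by apply: leq_trans iN.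
have [u0 uE s0 _] := ru; have [v0 vE z0 _] := rv.
have su := size_pos_roots ru; have sv := size_pos_roots rv.
have wr x : u^`().[x] * v.[x] - u.[x] * v^`().[x] < 0.
  by apply: wronskian_lt0 => [|y y0]; [rewrite su|exact: laguerre_pair_neq0].
have us j : (j < n)%N -> u.[s j] = 0.
  by move=> jn; rewrite (horner_pos_roots _ ru) (bigD1 (Ordinal jn))//= subrr mul0r mulr0.
have l2 : 0 < lead_coef u ^+ 2 by rewrite exprn_even_gt0 ?lead_coef_eq0.
pose M := 1 + \sum_(j < n) (s j + z j).
have Ms j : (j < n)%N -> s j < M /\ z j < M.
  move=> jn; have : s j + z j < M; last by have := s0 _ jn; have := z0 _ jn; lra.
  rewrite /M (bigD1 (Ordinal jn))//= addrCA ltrDl ltr_pwDl// sumr_ge0// => k _.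
  by rewrite addr_ge0// ltW ?s0 ?z0.
pose x j := if (j < n)%N then s j else M.
have luv : 0 < lead_coef u * lead_coef v.
  have pp (b : R) : -1 < b -> 0 < (poch (b + 1) n)^-1.
    by move=> b1; rewrite invr_gt0 poch_gt0// -ltrBlDr sub0r.
  have b1 : -1 < a + 1 + 1 by have := a1; lra.
  have rn : (rate_poly cs)`_n != 0.
    by have := u0; rewrite -lead_coef_eq0 lead_coefE su/= coef_laguerre mulf_eq0 negb_or => /andP[].
  rewrite !lead_coefE su sv/= !coef_laguerre mulrACA -expr2.
  by rewrite mulr_gt0 ?exprn_even_gt0 ?mulr_gt0 ?pp.
(* The factor has the sign of [v] at the first zero of [u], where [u'] has the sign of
   [(-1)^(n - 1) * lead_coef u]. *)
have [||z' xz' vE'] := @alternation_roots _ v n x ((-1) ^+ n * lead_coef u) sv.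
- move=> j jn; rewrite /x jn; case: ifP => [j1|_]; last by have [] := Ms _ jn.
  by apply: (pos_roots_lt ru); rewrite ltnSn.
- move=> j; rewrite mulrA leq_eqVlt => /orP[/eqP->|jn].
    rewrite /x ltnn signr_subn// subnn expr0 mul1r (horner_pos_roots _ rv) mulrA mulr_gt0//.
    by apply: prodr_gt0 => k _; rewrite subr_gt0; have [] := Ms _ (ltn_ord k).
  rewrite signr_subn 1?ltnW// /x jn; have := wr (s j); rewrite us// mul0r subr0.
  rewrite uE derivZ hornerZ horner_deriv_prod_root//.
  have := @prod_sign R (fun k => if k == j then 1 else s j - s k) n j.+1 jn.
  set P := \prod_(k < n) _ => H h.
  have {}H : 0 < (-1) ^+ (n - j.+1) * P.
    apply: H => k.
      by rewrite ltnS leq_eqVlt; case: eqP => //= _ kj; rewrite subr_gt0 (pos_roots_lt ru)// kj.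
    by move=> /andP[jk kn]; rewrite gtn_eqF// subr_lt0 (pos_roots_lt ru)// jk.
  rewrite -uE -(subnSK jn) exprS; set e := (-1) ^+ _ in H *.
  have : 0 < (e * P) * - (lead_coef u * P * v.[s j]) by rewrite mulr_gt0// oppr_gt0 h.
  rewrite (_ : _ * - _ = P ^+ 2 * (-1 * e * lead_coef u * v.[s j])); last by ring.
  have P0 : P != 0 by apply: contraTneq H => ->; rewrite mulr0 ltxx.
  by rewrite pmulr_rgt0// exprn_even_gt0.
have rv' : pos_roots z' n v.
  split=> // [j jn|j jn].
    by have /andP[h _] := xz' _ jn; apply: lt_trans h; rewrite /x jn s0.
  have /andP[_ h1] := xz' _ (ltnW jn); have /andP[h2 _] := xz' _ jn.
  exact: lt_trans h1 h2.
rewrite (pos_roots_uniq rv rv') ?(ltnW iN)//.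
by have /andP[_ +] := xz' _ (ltnW iN); rewrite /x iN.
Qed.

End Wronskian.

(** * Euler operators and multiplicity of zeros *)

Section Euler.
Variable F : numFieldType.
Implicit Types (b y : F) (f : {poly F}).

(* [(b + k - 1 + X d/dX) ... (b + 1 + X d/dX) (b + X d/dX) f] *)
Fixpoint euler_iter b k f : {poly F} :=
  if k is k'.+1 then euler_iter (b + 1) k' (b *: f + 'X * f^`()) else f.

Lemma coef_euler_iter b k f i : (euler_iter b k f)`_i = f`_i * poch (b + i%:R) k.
Proof.
elim: k b f => [|k IH] b f /=; first by rewrite poch0 mulr1.
rewrite IH coefD coefZ coefXM coef_deriv pochSl addrAC mulrA; congr (_ * _).
case: i {IH} => [|i] /=; first by ring.
by rewrite -[_ *+ i.+1]mulr_natl; ring.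
Qed.

(** Induction gives order at least [n] at [y] for both [f] and [b f + x f']. If [n > 0] and [f] had
    order exactly [n], then [x f'] would have order only [n - 1], as [y] is nonzero. *)
Lemma dvdp_euler_iter b y n f : y != 0 ->
  (forall k, (k < n)%N -> (euler_iter b k f).[y] = 0) -> ('X - y%:P) ^+ n %| f.
Proof.
move=> y0; elim: n b f => [|n IH] b f h; first by rewrite expr0 dvd1p.
have fy : f.[y] = 0 by apply: (h 0%N).
have h1 : ('X - y%:P) ^+ n %| f by apply: (IH b) => k kn; apply: h; rewrite ltnW.
have h2 : ('X - y%:P) ^+ n %| b *: f + 'X * f^`().
  by apply: (IH (b + 1)) => k kn; apply: (h k.+1).
case: n {IH h} h1 h2 => [|m] h1 h2; first by rewrite expr1 dvdp_XsubCl; apply/rootP.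
have /dvdpP[q fE] := h1.
have X0 : 'X - y%:P != 0 := negbT (polyXsubC_eq0 y).
(* For [f = q (x - y)^(m + 1)] this is the only term of [x f'] that may have order [m]; its
   divisibility means [q(y) = 0]. *)
have : ('X - y%:P) ^+ m.+1 %| ('X - y%:P) ^+ m * ((m.+1)%:R *: ('X * q)).
  have -> : ('X - y%:P) ^+ m * ((m.+1)%:R *: ('X * q)) =
      (b *: f + 'X * f^`()) - b *: f - 'X * q^`() * ('X - y%:P) ^+ m.+1.
    rewrite fE derivM deriv_exp derivXsubC mul1r /= scaler_nat.
    rewrite -[('X * q) *+ _]mulr_natl -[_ ^+ m *+ _]mulr_natl -!mul_polyC exprS.
    ring.
  apply: dvdp_sub; last exact: dvdp_mull.
  by apply: dvdp_sub => //; rewrite -mul_polyC dvdp_mull.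
rewrite exprSr dvdp_mul2l ?expf_neq0// dvdp_XsubCl rootZ ?pnatr_eq0//.
rewrite rootM rootX (negbTE y0)/= -dvdp_XsubCl => qy.
by rewrite fE mulrC exprSr dvdp_mul.
Qed.

End Euler.

(** * Divisibility by the rate polynomial *)

Section MomentAlgebra.
Variable R : rcfType.

Lemma rate_polyE r (c : 'I_r -> R) (n : 'I_r -> nat) :
  rate_poly (flatten [seq nseq (n j) (c j) | j <- enum 'I_r]) = \prod_(j < r) (1 - c j *: 'X) ^+ n j.
Proof.
rewrite /rate_poly big_flatten big_map big_enum/=; apply: eq_bigr => j _.
by rewrite big_nseq; elim: (n j) => //= m ->; rewrite exprS.
Qed.

(** The factors for different [j] are coprime, since the [(c j)^-1] are distinct. *)
Lemma dvdp_rate_poly r (c : 'I_r -> R) (n : 'I_r -> nat) (f : {poly R}) :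
  (forall j, 0 < c j) -> injective c ->
  (forall j, ('X - (c j)^-1%:P) ^+ n j %| f) ->
  rate_poly (flatten [seq nseq (n j) (c j) | j <- enum 'I_r]) %| f.
Proof.
move=> c0 ci df; rewrite rate_polyE.
have lin j : (1 - c j *: 'X) = - c j *: ('X - (c j)^-1%:P) :> {poly R}.
  rewrite scalerBr -[_ *: _%:P]mul_polyC -polyCM mulNr mulfV ?lt0r_neq0// polyCN opprK scaleNr addrC.
  by [].
have : uniq (index_enum 'I_r) := index_enum_uniq _.
elim: (index_enum 'I_r) => [|i s IH] /=; first by rewrite big_nil dvd1p.
move=> /andP[nis /IH ds]; rewrite big_cons Gauss_dvdp ?ds ?andbT.
  by rewrite lin exprZn dvdpZl ?df// expf_neq0// oppr_eq0 lt0r_neq0.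
apply: coprimep_expl; rewrite lin coprimepZl ?oppr_eq0 ?lt0r_neq0//.
rewrite coprimep_sym coprimep_XsubC /root horner_prod prodf_seq_neq0.
apply/allP => j js; rewrite horner_exp expf_neq0// !hornerE subr_eq0 eq_sym.
rewrite -[_ == _](inj_eq (mulIf (lt0r_neq0 (c0 i)))) divfK ?lt0r_neq0// mul1r (inj_eq ci).
by apply: contraNneq nis => <-.
Qed.

End MomentAlgebra.

(** * From the orthogonality relations to the explicit coefficients *)

Section Orthogonality.
Variable R : realType.
Notation mu := (@lebesgue_measure R).

Lemma gamma_int_addn (a c : R) m : -1 < a -> 0 < c ->
  c ^+ m * gamma_int (a + m%:R) c = poch (a + 1) m * gamma_int a c.
Proof.
move=> a1 c0; elim: m => [|m IH]; first by rewrite addr0 poch0 !mul1r.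
have am : -1 < a + m%:R by rewrite ltr_wpDr.
rewrite exprSr -mulrA -natr1 addrA gamma_int_succ// mulrCA IH pochS.
by ring.
Qed.

Lemma integral_poly_gammak (p : {poly R}) (a c : R) : -1 < a -> 0 < c ->
  (\int[mu]_(x in `]0%R, +oo[) (p.[x] * x `^ a * expR (- (c * x)))%:E =
   (\sum_(i < size p) p`_i * gamma_int (a + i%:R) c)%:E)%E.
Proof.
move=> a1 c0; have ai i : -1 < a + i%:R by rewrite ltr_wpDr.
transitivity (\int[mu]_(x in `]0%R, +oo[) (\sum_(i < size p) (p`_i * gammak (a + i%:R) c x)%:E))%E.
  apply: eq_integral => x; rewrite inE/= in_itv/= andbT => x0.
  rewrite sumEFin horner_coef !mulr_suml; congr (_%:E); apply: eq_bigr => i _.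
  rewrite /gammak powRD ?(gt_eqF x0) ?implybT// powR_mulrn ?ltW//; ring.
rewrite integral_sum//=; last first.
  by move=> i; apply: integrableZl (integrable_gammak (ai i) c0); exact: measurable_itv.
rewrite -sumEFin; apply: eq_bigr => i _.
rewrite EFinM -gamma_intE// -integralZl//; exact: integrable_gammak.
Qed.

(** By [gamma_int_addn] the [k]-th moment is a nonzero multiple of the sum of the
    [p_i (a + 1)_(i + k) (c j)^(-i)], and [(a + 1)_(i + k) = (a + 1)_i (a + 1 + i)_k] makes this sum
    the value at [(c j)^-1] of [euler_iter (a + 1) k] applied to the polynomial on the right. *)
Lemma mlaguerre2_dvdp r (n : 'I_r -> nat) (a : R) (c : 'I_r -> R) p j :
  is_mlaguerre2 n a c p -> -1 < a -> 0 < c j ->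
  ('X - (c j)^-1%:P) ^+ n j %| \poly_(i < size p) (p`_i * poch (a + 1) i).
Proof.
move=> [_ _ orth] a1 c0; apply: (@dvdp_euler_iter _ (a + 1)); first by rewrite invr_eq0 lt0r_neq0.
move=> k kn; have := orth j k kn; rewrite integral_poly_gammak//; last by rewrite addrC ltr_wpDr.
move=> [H]; set F := \poly_(i < _) _.
have sF : (size (euler_iter (a + 1) k F) <= size p)%N.
  by apply/leq_sizeP => i pi; rewrite coef_euler_iter coef_poly ltnNge pi/= mul0r.
rewrite (horner_coef_wide _ sF).
have g0 := gamma_int_gt0 a1 c0.
have ck : (c j)^-1 ^+ k * gamma_int a (c j) != 0 by rewrite mulf_neq0 ?expf_neq0 ?invr_eq0 ?lt0r_neq0.
apply: (mulIf ck); rewrite mul0r -[RHS]H mulr_suml; apply: eq_bigr => i _.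
rewrite coef_euler_iter coef_poly ltn_ord.
have -> : gamma_int (k%:R + a + i%:R) (c j) = (c j)^-1 ^+ (i + k) * (poch (a + 1) (i + k) * gamma_int a (c j)).
  rewrite -gamma_int_addn// mulrA -exprMn mulVf ?lt0r_neq0// expr1n mul1r.
  by congr gamma_int; rewrite natrD; ring.
rewrite pochD exprD; ring.
Qed.

(** Both [rate_poly cs] and the polynomial with coefficients [p_i (a + 1)_i] have degree the sum of
    the [n j], so divisibility makes them proportional. *)
Lemma mlaguerre2_laguerre r (n : 'I_r -> nat) (a : R) (c : 'I_r -> R) p :
  is_mlaguerre2 n a c p -> -1 < a -> (forall j, 0 < c j) -> injective c ->
  let cs := flatten [seq nseq (n j) (c j) | j <- enum 'I_r] in
  all (> 0) cs /\ exists2 k, k != 0 & p = k *: laguerre a cs.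
Proof.
move=> hp a1 c0 ci cs; have [mp sp _] := hp.
have a0 : 0 < a + 1 by rewrite -ltrBlDr sub0r.
pose F := \poly_(i < size p) (p`_i * poch (a + 1) i).
have dF : rate_poly cs %| F by apply: dvdp_rate_poly => // j; apply: mlaguerre2_dvdp.
have pn i : poch (a + 1) i != 0 by rewrite lt0r_neq0 ?poch_gt0.
have sF : size F = size p.
  apply: size_poly_eq; rewrite mulf_neq0// -lead_coefE lead_coef_eq0.
  by rewrite monic_neq0.
have scs : size cs = (\sum_(j < r) n j)%N.
  rewrite /cs size_flatten /shape -map_comp sumnE big_map big_enum/=.
  by apply: eq_bigr => j _; rewrite size_nseq.
have cpos : all (> 0) cs.
  by apply/allP => x /flattenP[_ /mapP[j _ ->]] /nseqP[-> _].
have sr : size (rate_poly cs) = size F by rewrite size_rate_poly_pos// scs sF sp.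
have /eqpP[[k1 k2] /= /andP[k10 k20] E] : rate_poly cs %= F by rewrite -dvdp_size_eqp// sr.
split=> //; exists (k1 / k2); first by rewrite mulf_neq0 ?invr_eq0.
apply/polyP => i; rewrite coefZ coef_laguerre.
have := congr1 (fun q : {poly R} => q`_i) E; rewrite !coefZ coef_poly.
case: ltnP => ip H.
  have -> : p`_i = (k2 * (p`_i * poch (a + 1) i)) / k2 / poch (a + 1) i by field; rewrite k20 pn.
  by rewrite -H; field; rewrite k20 pn.
rewrite nth_default//; have -> : (rate_poly cs)`_i = 0.
  by apply/eqP; have /eqP := H; rewrite mulr0 mulf_eq0 (negbTE k10).
by rewrite mul0r mulr0.
Qed.
End Orthogonality.

(** * The interlacing *)

Lemma sorted_zeros_pos_roots (R : realType) s n (p : {poly R}) :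
  pos_roots s n p -> sorted_zeros p (mkseq s n).
Proof.
move=> rp; have [p0 pE _ _] := rp; split=> //; first by rewrite prod_mkseq.
by apply: sub_sorted (pos_roots_sorted rp) => x y; exact: ltW.
Qed.

Unset Implicit Arguments.

Theorem theorem5p11 (R : realType) (r : nat) (hr : (0 < r)%N)
    (n : 'I_r -> nat) (hn : forall j, (0 < n j)%N)
    (alpha : R) (halpha : -1 < alpha)
    (c : 'I_r -> R) (hc : forall j, 0 < c j)
    (hcdist : forall i j, i != j -> c i != c j)
    (t : R) (ht0 : 0 < t) (ht2 : t <= 2)
    (p q : {poly R})
    (hp : is_mlaguerre2 n alpha c p)
    (hq : is_mlaguerre2 n (alpha + t) c q) :
  interlaces p q.
Proof.
have ci : injective c.
  by move=> i j /eqP; apply: contraTeq; exact: hcdist.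
have ha2 : -1 < alpha + t by rewrite (lt_trans halpha)// ltrDl.
have [c0 [k k0 pE]] := mlaguerre2_laguerre hp halpha hc ci.
have [_ [l l0 qE]] := mlaguerre2_laguerre hq ha2 hc ci.
set cs := flatten _ in c0 pE qE; set N := size cs.
have [s rs] := laguerre_roots c0 halpha.
have [z rz] := laguerre_roots c0 ha2.
(* The zeros [y] for [alpha + 2] serve as a bridge: [z i <= y i] by monotonicity, as [t <= 2], and
   [y i < s i.+1]. *)
have ha3 : -1 < alpha + 1 + 1 by lra.
have [y ry] := laguerre_roots c0 ha3.
exists (mkseq s N), (mkseq z N); split.
- by apply: sorted_zeros_pos_roots; rewrite pE; exact: pos_rootsZ.
- by apply: sorted_zeros_pos_roots; rewrite qE; exact: pos_rootsZ.
- by rewrite !size_mkseq.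
- move=> i; rewrite size_mkseq => iN; rewrite !nth_mkseq//.
  by apply: (laguerre_mono c0 halpha _ rs rz) => //; rewrite lerDl ltW.
- move=> i; rewrite size_mkseq => iN; rewrite !nth_mkseq// ?(ltnW iN)//.
  apply: (@le_trans _ _ (y i)); last exact/ltW/(laguerre_roots_next halpha c0 rs ry).
  by apply: (laguerre_mono c0 ha2 _ rz ry); [lra|exact: ltnW].
Qed.
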